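(* Let $\{f(\cdot;s)\}_{s\ge 0}$ be a one-parameter family of nonlinearities satisfying assumptions (A1)-(A5) listed in the context, with $c^*(s)$ the minimal traveling wave speed and $W_s$ the minimal traveling wave (the traveling wave with speed $c^*(s)$). Then there exists a threshold value $s^*\in[s_1,s_2)$ such that $$c^*(s)=2\quad\text{for all } s\in[0,s^*];\qquad c^*(s)>2\quad\text{for all } s\in(s^*,\infty).$$ Moreover, the minimal traveling wave $W_s(\xi)$ satisfies: (1) if $s<s^*$, then $W_s(\xi)=A\xi e^{-\xi}+o(\xi e^{-\xi})$ as $\xi\to+\infty$ for some $A>0$; (2) if $s=s^*$, then $W_s(\xi)=Be^{-\xi}+o(e^{-\xi})$ as $\xi\to+\infty$ for some $B>0$.
   Context: Consider the family of scalar reaction-diffusion equations $w_t=w_{xx}+f(w;s)$, $s\in[0,\infty)$. Primes on $f$ denote derivatives with respect to $w$. Assumptions: (A1) (monostable) For all $s\ge0$: $f(\cdot;s)\in C^2([0,1])$, $f(0;s)=f(1;s)=0$, $f'(0;s)=\gamma_0=1>0>f'(1;s)$, and $f(w;s)>0$ for all $w\in(0,1)$. (A2) (Lipschitz continuity) There exists $L_0>0$ such that $|f^{(n)}(w;s_1)-f^{(n)}(w;s_2)|\le L_0|s_1-s_2|$ for all $w\in[0,1]$, all parameter values $s_1,s_2\ge 0$, and $n=0,1,2$, where $f^{(n)}$ is the $n$-th derivative in $w$. (A3) (monotonicity) If $\hat s>s$, then $f(w;\hat s)>f(w;s)$ for all $w\in(0,1)$, and $f''(0;\hat s)>f''(0;s)$.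 (A4) There exists $s_1>0$ such that $f(\cdot;s_1)$ satisfies the KPP condition $f'(0;s_1)w\ge f(w;s_1)$ for all $w\in[0,1]$ (and thus $c^*(s_1)=2$). (A5) There exists $s_2>s_1$ such that $c^*(s_2)>2$. Here, for each $s\ge 0$, $c^*(s)$ is the minimal traveling wave speed: it is known that under (A1) there is $c^*(s)\ge 2$ such that the problem $$W''+cW'+f(W;s)=0\ \text{ in }\mathbb{R},\quad W(-\infty)=1,\ W(+\infty)=0,\ W'<0\ \text{ in }\mathbb{R}$$ admits a solution $W$, unique up to translation, if and only if $c\ge c^*(s)$. $W_s$ denotes the solution with $c=c^*(s)$. *)

(* Defs.v *)
From Stdlib Require Import Reals.
From Coquelicot Require Import Coquelicot.
Open Scope R_scope.

Definition I01 (w : R) : Prop := 0 <= w <= 1.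

(* [D_in] and [continue_in] are relative to the closed interval, so they are
   one-sided at 0 and 1. No value of [g] outside [0,1] is constrained. *)
Definition C2_on01 (g g1 g2 : R -> R) : Prop :=
  forall w, I01 w ->
    D_in g g1 I01 w /\ D_in g1 g2 I01 w /\ continue_in g2 I01 w.

Definition monostable (g g1 g2 : R -> R) : Prop :=
  C2_on01 g g1 g2 /\
  g 0 = 0 /\ g 1 = 0 /\
  g1 0 = 1 /\ g1 1 < 0 /\
  (forall w, 0 < w < 1 -> 0 < g w).

(* In a family [f s w] the parameter comes first; only [0 <= s] matters. *)
Definition lipschitz_in_parameter (f f1 f2 : R -> R -> R) : Prop :=
  exists L0 : R, 0 < L0 /\
    forall w s s', I01 w -> 0 <= s -> 0 <= s' ->
      Rabs (f s w - f s' w) <= L0 * Rabs (s - s') /\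
      Rabs (f1 s w - f1 s' w) <= L0 * Rabs (s - s') /\
      Rabs (f2 s w - f2 s' w) <= L0 * Rabs (s - s').

Definition increasing_in_parameter (f f2 : R -> R -> R) : Prop :=
  forall s s', 0 <= s -> s < s' ->
    (forall w, 0 < w < 1 -> f s w < f s' w) /\ f2 s 0 < f2 s' 0.

Definition KPP (g g1 : R -> R) : Prop :=
  forall w, I01 w -> g w <= g1 0 * w.

Definition traveling_wave (g : R -> R) (c : R) (W : R -> R) : Prop :=
  (forall x, ex_derive W x /\ ex_derive (Derive W) x) /\
  (forall x, Derive (Derive W) x + c * Derive W x + g (W x) = 0) /\
  is_lim W m_infty 1 /\
  is_lim W p_infty 0 /\
  (forall x, Derive W x < 0).

(* Determines [c] uniquely. *)
Definition is_minimal_speed (g : R -> R) (c : R) : Prop :=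
  forall c', (exists W, traveling_wave g c' W) <-> c <= c'.

(* [h = o(g)] at +infinity; [is_domin] takes the dominating function first. *)
Definition little_o_pinfty (h g : R -> R) : Prop :=
  is_domin (Rbar_locally p_infty) g h.

(* Main.v *)
Require Import Defs.
From Stdlib Require Import Reals Ranalysis5 Lra Lia Psatz.
From Coquelicot Require Import Coquelicot.
Open Scope R_scope.

(** At speed 2, [W' ^ 2] regarded as a function [U] of the height [w = W]
    satisfies [U' = 4 sqrt U - 2 f], with [U 1 = 0]. Solved from [w = 1] down to
    [w = 0] this is a dissipative equation: the unknown enters through an
    increasing function, so solutions compare with each other and depend on [f]
    in a Lipschitz way, although the square root is singular. The solution exists
    for every monostable [f] ([flux_profile_exists]), and a wave of speed 2 exists exactly
    when it also vanishes at [w = 0] ([wave_flux_at_0], [wave_exists]). No wave is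
    slower than 2 ([wave_speed_ge_2]). Hence [cstar s = 2] is equivalent to [U 0 = 0] for
    the profile of [f s], a condition that passes to smaller [s] by comparison,
    passes to limits by continuity, holds at [s1] because [w ^ 2] is a
    supersolution under the KPP condition, and fails at [s2]. The
    threshold is the supremum of the parameters where it holds.

    For the tail, put [v = exp x * W]. Then [v'' = exp x * (W - f W)] is [exp x]
    times a term quadratic in [W], hence exponentially small by [wave_exp_upper],
    so [v = A x + B] up to an exponentially small error, and either [A > 0] (slow)
    or [A = 0 < B] (fast); this is [wave_edge_dichotomy].

    - A fast wave cannot be followed by a strictly larger reaction that still
      admits speed 2 ([edge_slow_below]): the gap between the two slopes at
      equal height would decay no faster than [W] itself, whereas both slopes are
      [W (1 + o(1))]. So the waves below the threshold are slow.
    - A slow wave has [sqrt (U w) = w (1 - (1 + o(1)) / |ln w|)], strictly below the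
      supersolution [w (1 - 1 / (2 |ln w|))]. This margin absorbs a small increase of the
      reaction ([slow_edge_open]). So the wave at the threshold is fast. *)

(** * Comparison through derivatives *)

Ltac reals_eq := match goal with |- @eq _ ?a ?b => change (@eq R a b) end.

Ltac by_smoothness :=
  match goal with |- continuous ?f ?x =>
    apply (ex_derive_continuous f x); auto_derive; try exact I end.

Lemma continuous_Rplus (f g : R -> R) (x : R) :
  continuous f x -> continuous g x -> continuous (fun y => f y + g y) x.
Proof. exact (continuous_plus f g x). Qed.

Lemma continuous_Rminus (f g : R -> R) (x : R) :
  continuous f x -> continuous g x -> continuous (fun y => f y - g y) x.
Proof. exact (continuous_minus f g x). Qed.

Lemma continuous_Rmult (f g : R -> R) (x : R) :
  continuous f x -> continuous g x -> continuous (fun y => f y * g y) x.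
Proof. exact (continuous_mult f g x). Qed.

Lemma continuous_Rcomp (f g : R -> R) (x : R) :
  continuous f x -> continuous g (f x) -> continuous (fun y => g (f y)) x.
Proof. exact (continuous_comp f g x). Qed.

Lemma continuous_Rconst (c x : R) : continuous (fun _ : R => c) x.
Proof. exact (continuous_const c x). Qed.

Lemma continuity_pt_of_continuous (f : R -> R) (x : R) :
  continuous f x -> continuity_pt f x.
Proof. intros h. apply continuity_pt_filterlim. exact h. Qed.

Lemma locally_between (P : R -> Prop) (a x b : R) :
  a < x < b -> (forall y, a < y < b -> P y) -> locally x P.
Proof.
intros hx hP.
assert (hm : 0 < Rmin (x - a) (b - x)) by (apply Rmin_glb_lt; lra).
exists (mkposreal _ hm). intros y hy.
change (Rabs (y - x) < Rmin (x - a) (b - x)) in hy.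
apply Rabs_def2 in hy.
assert (h1 := Rmin_l (x - a) (b - x)). assert (h2 := Rmin_r (x - a) (b - x)).
apply hP. lra.
Qed.

Lemma mean_value (f df : R -> R) (a b : R) :
  a < b ->
  (forall x, a <= x <= b -> continuous f x) ->
  (forall x, a < x < b -> is_derive f x (df x)) ->
  exists c, a < c < b /\ f b - f a = df c * (b - a).
Proof.
intros hab hc hd.
assert (pr1 : forall c, a < c < b -> derivable_pt f c).
{ intros c h. exists (df c). apply is_derive_Reals, hd, h. }
assert (pr2 : forall c, a < c < b -> derivable_pt id c).
{ intros c _. apply derivable_pt_id. }
destruct (MVT f id a b pr1 pr2 hab) as [c [P E]].
- intros c h. apply continuity_pt_filterlim, hc, h.
- intros c h. apply derivable_continuous_pt, derivable_pt_id.
- exists c; split; [exact P|].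
  replace (derive_pt id c (pr2 c P)) with 1 in E
    by (symmetry; apply derive_pt_eq; apply derivable_pt_lim_id).
  unfold id in E.
  replace (derive_pt f c (pr1 c P)) with (df c) in E
    by (symmetry; apply derive_pt_eq; apply is_derive_Reals, hd, P).
  lra.
Qed.

Lemma nondecreasing_of_derive (f df : R -> R) (a b : R) :
  a <= b ->
  (forall x, a <= x <= b -> continuous f x) ->
  (forall x, a < x < b -> is_derive f x (df x)) ->
  (forall x, a < x < b -> 0 <= df x) ->
  f a <= f b.
Proof.
intros hab hc hd hpos.
destruct (Req_dec a b) as [<-|ne]; [lra|].
destruct (mean_value f df a b) as [c [h E]]; try assumption; [lra|].
assert (0 <= df c * (b - a)) by (apply Rmult_le_pos; [apply hpos, h|lra]).
lra.
Qed.

Lemma is_derive_sqr_pos_part (x : R) :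
  is_derive (fun y => Rmax y 0 * Rmax y 0) x (2 * Rmax x 0).
Proof.
destruct (Rtotal_order x 0) as [h|[->|h]].
- apply is_derive_ext_loc with (fun _ => 0).
  + apply (locally_between _ (x - 1) _ 0); [lra|]. intros y hy.
    rewrite Rmax_right by lra. reals_eq; ring.
  + rewrite (Rmax_right x 0) by lra. rewrite Rmult_0_r. apply (is_derive_const 0).
- apply is_derive_Reals. intros eps heps.
  exists (mkposreal eps heps). intros h hne hlt. simpl in hlt.
  rewrite (Rmax_left 0 0) by lra. rewrite Rplus_0_l.
  unfold Rmax; destruct (Rle_dec h 0).
  + replace ((0 * 0 - 0 * 0) / h - 2 * 0) with 0 by (field; exact hne).
    rewrite Rabs_R0. exact heps.
  + replace ((h * h - 0 * 0) / h - 2 * 0) with h by (field; exact hne). exact hlt.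
- apply is_derive_ext_loc with (fun y => y * y).
  + apply (locally_between _ 0 _ (x + 1)); [lra|]. intros y hy.
    rewrite Rmax_left by lra. reals_eq; ring.
  + rewrite (Rmax_left x 0) by lra. auto_derive; [exact I|ring].
Qed.

(** The square of the positive part of [F] is differentiable and cannot increase. *)
Lemma forward_comparison (F dF : R -> R) (a b : R) :
  a <= b ->
  (forall x, a <= x <= b -> continuous F x) ->
  (forall x, a < x < b -> is_derive F x (dF x)) ->
  (forall x, a < x < b -> 0 < F x -> dF x <= 0) ->
  F a <= 0 -> F b <= 0.
Proof.
intros hab hc hd hs ha.
set (q := fun y => Rmax y 0 * Rmax y 0).
assert (H : - q (F a) <= - q (F b)).
{ apply (nondecreasing_of_derive (fun x => - q (F x))
           (fun x => - (dF x * (2 * Rmax (F x) 0))) a b hab).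
  - intros x hx. apply (continuous_opp (fun x => q (F x))).
    apply (continuous_comp F q); [apply hc, hx|].
    apply (ex_derive_continuous q). eexists. apply is_derive_sqr_pos_part.
  - intros x hx. apply (is_derive_opp (fun x => q (F x))).
    apply (is_derive_comp q F); [apply is_derive_sqr_pos_part|apply hd, hx].
  - intros x hx. unfold Rmax; destruct (Rle_dec (F x) 0) as [h|h]; [lra|].
    apply Rnot_le_lt in h. specialize (hs x hx h). nra. }
unfold q in H. rewrite (Rmax_right (F a) 0) in H by lra.
destruct (Rle_dec (F b) 0) as [h|h]; [exact h|].
rewrite (Rmax_left (F b) 0) in H by lra. nra.
Qed.

(** Comparison from right to left, the direction in which the equations below are
    stable; [e] is the defect allowed in the differential inequality. *)
Lemma backward_comparison (u v du dv : R -> R) (a b e : R) :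
  a <= b -> 0 <= e ->
  (forall x, a <= x <= b -> continuous u x) ->
  (forall x, a <= x <= b -> continuous v x) ->
  (forall x, a < x < b -> is_derive u x (du x)) ->
  (forall x, a < x < b -> is_derive v x (dv x)) ->
  (forall x, a < x < b -> v x < u x -> dv x - e <= du x) ->
  u b <= v b -> u a <= v a + e * (b - a).
Proof.
intros hab he hcu hcv hdu hdv hs hb.
assert (H : u (- (- a)) - v (- (- a)) - e * (b + - a) <= 0).
{ apply (forward_comparison (fun x => u (- x) - v (- x) - e * (b + x))
    (fun x => - du (- x) + dv (- x) - e) (- b) (- a)); [lra| | | |].
  - intros x hx. apply continuous_Rminus; [apply continuous_Rminus|].
    + apply (continuous_Rcomp Ropp u); [by_smoothness|apply hcu; lra].
    + apply (continuous_Rcomp Ropp v); [by_smoothness|apply hcv; lra].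
    + by_smoothness.
  - intros x hx.
    assert (h1 := hdu (- x) ltac:(lra)). assert (h2 := hdv (- x) ltac:(lra)).
    auto_derive.
    + repeat split; eexists; eassumption.
    + change (fun x => u x) with u. change (fun x => v x) with v.
      rewrite (is_derive_unique _ _ _ h1), (is_derive_unique _ _ _ h2). ring.
  - intros x hx hpos. 
    assert (0 <= e * (b + x)) by (apply Rmult_le_pos; lra).
    specialize (hs (- x) ltac:(lra) ltac:(lra)). lra.
  - rewrite Ropp_involutive. replace (b + - b) with 0 by ring. lra. }
rewrite Ropp_involutive in H. lra.
Qed.

(** Functions given on [0,1] are extended by constants, which makes them continuous
    on the whole line. *)
Definition clamp (t : R) : R := Rmax 0 (Rmin 1 t).

Lemma clamp_range t : 0 <= clamp t <= 1.
Proof.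
unfold clamp, Rmax, Rmin; repeat destruct Rle_dec; lra.
Qed.

Lemma clamp_id t : 0 <= t <= 1 -> clamp t = t.
Proof.
intros h; unfold clamp, Rmax, Rmin; repeat destruct Rle_dec; lra.
Qed.

Lemma clamp_lipschitz s t : Rabs (clamp s - clamp t) <= Rabs (s - t).
Proof.
unfold clamp, Rmax, Rmin, Rabs; repeat destruct Rle_dec; repeat destruct Rcase_abs; lra.
Qed.

Lemma continuous_eps (f : R -> R) (x : R) :
  continuous f x <->
  forall e, 0 < e -> exists d, 0 < d /\ forall y, Rabs (y - x) < d -> Rabs (f y - f x) < e.
Proof.
split.
- intros h e he. apply continuity_pt_filterlim in h. destruct (h e he) as [d [hd H]].
  exists d; split; [exact hd|]. intros y hy.
  destruct (Req_dec y x) as [->|ne]; [rewrite Rminus_diag, Rabs_R0; exact he|].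
  apply (H y). split; [split; [exact I|congruence]|exact hy].
- intros h. apply continuity_pt_filterlim. intros e he. destruct (h e he) as [d [hd H]].
  exists d; split; [exact hd|]. intros y [_ hy]. apply (H y hy).
Qed.

Lemma continuous_lipschitz (f : R -> R) (M : R) :
  (forall x y, Rabs (f x - f y) <= M * Rabs (x - y)) -> forall x, continuous f x.
Proof.
intros h x. apply continuous_eps. intros e he.
assert (hM : 0 < Rabs M + 1) by (assert (H := Rabs_pos M); lra).
exists (e / (Rabs M + 1)). split; [apply Rdiv_lt_0_compat; lra|].
intros y hy. apply Rle_lt_trans with (1 := h y x).
apply Rle_lt_trans with ((Rabs M + 1) * Rabs (y - x)).
- apply Rmult_le_compat_r; [apply Rabs_pos|]. assert (H := Rle_abs M). lra.
- apply Rmult_lt_reg_r with (/ (Rabs M + 1)); [apply Rinv_0_lt_compat, hM|].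
  replace ((Rabs M + 1) * Rabs (y - x) * / (Rabs M + 1)) with (Rabs (y - x)) by (field; lra).
  exact hy.
Qed.

Lemma continuous_clamp t : continuous clamp t.
Proof.
apply (continuous_lipschitz clamp 1). intros; rewrite Rmult_1_l; apply clamp_lipschitz.
Qed.

Lemma sqrt_diff_le x y : Rabs (sqrt x - sqrt y) <= sqrt (Rabs (x - y)).
Proof.
assert (W : forall a b, b <= a -> Rabs (sqrt a - sqrt b) <= sqrt (Rabs (a - b))).
{ intros a b h. rewrite (Rabs_right (a - b)) by lra.
  assert (hs := sqrt_le_1_alt _ _ h).
  rewrite Rabs_right by lra.
  destruct (Rle_dec 0 b) as [hb|hb].
  - assert (h1 := sqrt_sqrt a ltac:(lra)). assert (h2 := sqrt_sqrt b hb).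
    assert (h3 := sqrt_sqrt (a - b) ltac:(lra)).
    assert (0 <= sqrt a) by apply sqrt_pos. assert (0 <= sqrt b) by apply sqrt_pos.
    assert (0 <= sqrt (a - b)) by apply sqrt_pos.
    apply Rnot_lt_le; intro. nra.
  - rewrite (sqrt_neg_0 b) by lra. rewrite Rminus_0_r. apply sqrt_le_1_alt. lra. }
destruct (Rle_dec y x) as [h|h]; [apply W, h|].
rewrite Rabs_minus_sym, (Rabs_minus_sym x). apply W. lra.
Qed.

(** * Solving the flux equation with a delay *)

Lemma tail_integral_derive (f : R -> R) (w : R) :
  (forall t, continuous f t) -> is_derive (fun a => RInt f a 1) w (- f w).
Proof.
intros hf. apply (is_derive_RInt' f _ w 1); [|apply hf].
apply filter_forall. intros a. apply (RInt_correct f).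
apply (ex_RInt_continuous f). intros; apply hf.
Qed.

Lemma tail_integral_lipschitz (f : R -> R) (M x y : R) :
  (forall t, continuous f t) -> (forall t, Rabs (f t) <= M) ->
  Rabs (RInt f (clamp x) 1 - RInt f (clamp y) 1) <= M * Rabs (x - y).
Proof.
intros hf hM.
assert (hi : forall a b, ex_RInt f a b)
  by (intros; apply (ex_RInt_continuous f); intros; apply hf).
assert (0 <= M) by (apply Rle_trans with (2 := hM 0), Rabs_pos).
assert (W : forall a b, a <= b -> Rabs (RInt f a 1 - RInt f b 1) <= (b - a) * M).
{ intros a b h.
  assert (E : RInt f a b + RInt f b 1 = RInt f a 1) by (apply (RInt_Chasles f); apply hi).
  replace (RInt f a 1 - RInt f b 1) with (RInt f a b) by lra.
  apply abs_RInt_le_const; [exact h|apply hi|intros; apply hM]. }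
apply Rle_trans with (M * Rabs (clamp x - clamp y)).
- destruct (Rle_dec (clamp x) (clamp y)) as [h|h].
  + rewrite (Rabs_left1 (clamp x - clamp y)) by lra. specialize (W _ _ h). lra.
  + rewrite Rabs_minus_sym, (Rabs_right (clamp x - clamp y)) by lra.
    specialize (W (clamp y) (clamp x) ltac:(lra)). lra.
- apply Rmult_le_compat_l; [assumption|apply clamp_lipschitz].
Qed.

(** Method of steps: the value at [w] depends on values at distance at least [d] to
    the right of [w], and everything vanishes at the right of 1, so [k] steps
    determine the solution of the delayed equation on [1 - k d, 1]. *)
Fixpoint delayed (G : R -> R) (d : R) (k : nat) (w : R) : R :=
  match k with
  | O => 0
  | S j => RInt (fun t => G t - 4 * sqrt (delayed G d j (t + d))) (clamp w) 1
  end.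

Lemma delayed_integrand_continuous (G v : R -> R) (d : R) :
  (forall t, continuous G t) -> (forall t, continuous v t) ->
  forall t, continuous (fun t => G t - 4 * sqrt (v (t + d))) t.
Proof.
intros hG hv t. apply continuous_Rminus; [apply hG|].
apply continuous_Rmult; [apply continuous_Rconst|].
apply (continuous_Rcomp (fun t => v (t + d)) sqrt); [|apply continuous_sqrt].
apply (continuous_Rcomp (fun t => t + d) v); [by_smoothness|apply hv].
Qed.

Lemma delayed_continuous (G : R -> R) (d : R) (k : nat) :
  (forall t, continuous G t) -> forall w, continuous (delayed G d k) w.
Proof.
intros hG. induction k as [|k IH]; intros w.
- apply continuous_Rconst.
- simpl. apply (continuous_Rcomp clamp
    (fun a => RInt (fun t => G t - 4 * sqrt (delayed G d k (t + d))) a 1)).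
  + apply continuous_clamp.
  + apply (ex_derive_continuous
      (fun a => RInt (fun t => G t - 4 * sqrt (delayed G d k (t + d))) a 1)).
    eexists. apply tail_integral_derive.
    apply delayed_integrand_continuous; assumption.
Qed.

Lemma delayed_le (G : R -> R) (d C : R) (k : nat) (w : R) :
  (forall t, continuous G t) -> (forall t, 0 <= G t <= C) ->
  delayed G d k w <= C.
Proof.
intros hG hC. assert (hC0 := hC 0). destruct k as [|k]; simpl; [lra|].
assert (hw := clamp_range w).
apply Rle_trans with (RInt (fun _ => C) (clamp w) 1).
- apply RInt_le; [lra| | |].
  + apply (ex_RInt_continuous (fun t => G t - 4 * sqrt (delayed G d k (t + d)))).
    intros; apply delayed_integrand_continuous; [assumption|].
    apply delayed_continuous, hG.
  + apply (ex_RInt_continuous (fun _ => C)). intros; apply continuous_Rconst.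
  + intros x _. assert (h := sqrt_pos (delayed G d k (x + d))). specialize (hC x). lra.
- rewrite RInt_const. unfold scal; simpl; unfold mult; simpl. nra.
Qed.

Lemma delayed_integrand_bound (G : R -> R) (d C : R) (k : nat) (t : R) :
  (forall t, continuous G t) -> (forall t, 0 <= G t <= C) ->
  Rabs (G t - 4 * sqrt (delayed G d k (t + d))) <= C + 4 * sqrt C.
Proof.
intros hG hC.
assert (h := sqrt_le_1_alt _ _ (delayed_le G d C k (t + d) hG hC)).
assert (h0 := sqrt_pos (delayed G d k (t + d))). specialize (hC t).
apply Rabs_le. lra.
Qed.

Lemma delayed_stable (G : R -> R) (d : R) (k : nat) :
  0 < d -> forall w, 1 - INR k * d <= w -> delayed G d (S k) w = delayed G d k w.
Proof.
intros hd. induction k as [|k IH]; intros w hw.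
- simpl in *. replace (clamp w) with 1.
  + exact (RInt_point 1 (fun t => G t - 4 * sqrt 0)).
  + unfold clamp, Rmax, Rmin; repeat destruct Rle_dec; lra.
- change (delayed G d (S (S k)) w) with
    (RInt (fun t => G t - 4 * sqrt (delayed G d (S k) (t + d))) (clamp w) 1).
  change (delayed G d (S k) w) with
    (RInt (fun t => G t - 4 * sqrt (delayed G d k (t + d))) (clamp w) 1).
  assert (hr := clamp_range w).
  apply RInt_ext. intros x. rewrite Rmin_left, Rmax_right by lra. intros hx.
  rewrite IH; [reflexivity|]. rewrite S_INR in hw.
  assert (w <= clamp w)
    by (revert hx; unfold clamp, Rmax, Rmin; repeat destruct Rle_dec; lra).
  lra.
Qed.

Definition delay (n : nat) : R := / INR (S n).

Definition tonelli (G : R -> R) (n : nat) : R -> R := delayed G (delay n) (S n).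

Lemma delay_pos n : 0 < delay n.
Proof. apply Rinv_0_lt_compat, lt_0_INR. lia. Qed.

Lemma tonelli_equation (G : R -> R) (n : nat) (w : R) :
  tonelli G n w =
  RInt (fun t => G t - 4 * sqrt (tonelli G n (t + delay n))) (clamp w) 1.
Proof.
unfold tonelli at 1. simpl delayed.
assert (hr := clamp_range w).
apply RInt_ext. intros x. rewrite Rmin_left, Rmax_right by lra. intros hx.
unfold tonelli. rewrite delayed_stable; [reflexivity|apply delay_pos|].
assert (h : INR (S n) * delay n = 1)
  by (unfold delay; apply Rinv_r, not_0_INR; discriminate).
rewrite S_INR in h. lra.
Qed.

Lemma tonelli_derive (G : R -> R) (n : nat) (w : R) :
  (forall t, continuous G t) -> 0 < w < 1 ->
  is_derive (tonelli G n) w (4 * sqrt (tonelli G n (w + delay n)) - G w).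
Proof.
intros hG hw.
set (f := fun t => G t - 4 * sqrt (tonelli G n (t + delay n))).
apply (is_derive_ext_loc (fun a => RInt f a 1)).
- apply (locally_between _ 0 _ 1); [lra|]. intros y hy.
  rewrite tonelli_equation, clamp_id by lra. reflexivity.
- replace (4 * sqrt (tonelli G n (w + delay n)) - G w) with (- f w) by (unfold f; ring).
  apply tail_integral_derive. apply delayed_integrand_continuous; [exact hG|].
  apply delayed_continuous, hG.
Qed.

Lemma tonelli_lipschitz (G : R -> R) (C : R) (n : nat) (x y : R) :
  (forall t, continuous G t) -> (forall t, 0 <= G t <= C) ->
  Rabs (tonelli G n x - tonelli G n y) <= (C + 4 * sqrt C) * Rabs (x - y).
Proof.
intros hG hC. unfold tonelli; simpl delayed. apply tail_integral_lipschitz.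
- apply delayed_integrand_continuous; [exact hG|apply delayed_continuous, hG].
- intros t. apply delayed_integrand_bound; assumption.
Qed.

(** What the common Lipschitz constant [C + 4 sqrt C] of the approximations allows
    [4 sqrt u] to change over one delay. *)
Definition delay_error (C : R) (n : nat) : R := 4 * sqrt ((C + 4 * sqrt C) * delay n).

Lemma delay_error_spec (G : R -> R) (C : R) (n : nat) (t : R) :
  (forall t, continuous G t) -> (forall t, 0 <= G t <= C) ->
  Rabs (4 * sqrt (tonelli G n (t + delay n)) - 4 * sqrt (tonelli G n t)) <= delay_error C n.
Proof.
intros hG hC. rewrite <- Rmult_minus_distr_l, Rabs_mult, (Rabs_right 4) by lra.
unfold delay_error. apply Rmult_le_compat_l; [lra|].
apply Rle_trans with (1 := sqrt_diff_le _ _). apply sqrt_le_1_alt.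
apply Rle_trans with (1 := tonelli_lipschitz G C n _ _ hG hC).
replace (t + delay n - t) with (delay n) by ring.
rewrite Rabs_right by (apply Rle_ge, Rlt_le, delay_pos). lra.
Qed.

Lemma tonelli_at_1 G n : tonelli G n 1 = 0.
Proof.
rewrite tonelli_equation. rewrite clamp_id by lra.
exact (RInt_point 1 (fun t => G t - 4 * sqrt (tonelli G n (t + delay n)))).
Qed.

Lemma tonelli_clamp G n w : tonelli G n (clamp w) = tonelli G n w.
Proof.
rewrite tonelli_equation, (tonelli_equation _ _ w).
rewrite (clamp_id (clamp w)); [reflexivity|apply clamp_range].
Qed.

(** The right-hand side is monotone in the unknown, so errors are not amplified: the
    approximations are Cauchy although the square root is not Lipschitz. *)
Lemma tonelli_cauchy (G : R -> R) (C : R) (n m : nat) (w : R) :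
  (forall t, continuous G t) -> (forall t, 0 <= G t <= C) ->
  Rabs (tonelli G n w - tonelli G m w) <= delay_error C n + delay_error C m.
Proof.
intros hG hC.
assert (hpos : forall k, 0 <= delay_error C k)
  by (intros k; unfold delay_error; apply Rmult_le_pos; [lra|apply sqrt_pos]).
assert (W : forall k l, tonelli G k (clamp w) <=
          tonelli G l (clamp w) + (delay_error C k + delay_error C l)).
{ intros k l. assert (hw := clamp_range w). assert (h1 := hpos k). assert (h2 := hpos l).
  apply Rle_trans with (tonelli G l (clamp w) + (delay_error C k + delay_error C l) * (1 - clamp w)); [|nra].
  apply (backward_comparison _ _ 
     (fun t => 4 * sqrt (tonelli G k (t + delay k)) - G t)
     (fun t => 4 * sqrt (tonelli G l (t + delay l)) - G t)); try lra.
  - intros; apply delayed_continuous, hG.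
  - intros; apply delayed_continuous, hG.
  - intros x hx. apply tonelli_derive; [exact hG|lra].
  - intros x hx. apply tonelli_derive; [exact hG|lra].
  - intros x hx hlt.
    assert (hk := delay_error_spec G C k x hG hC). assert (hl := delay_error_spec G C l x hG hC).
    assert (hs := sqrt_le_1_alt _ _ (Rlt_le _ _ hlt)).
    apply Rabs_le_between in hk. apply Rabs_le_between in hl. lra.
  - rewrite !tonelli_at_1. lra. }
rewrite <- (tonelli_clamp G n), <- (tonelli_clamp G m).
assert (h1 := W n m). assert (h2 := W m n). apply Rabs_le. lra.
Qed.

Lemma delay_error_lim (C : R) : is_lim_seq (delay_error C) 0.
Proof.
assert (E : 4 * sqrt ((C + 4 * sqrt C) * 0) = 0).
{ replace ((C + 4 * sqrt C) * 0) with 0 by ring. rewrite sqrt_0. ring. }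
rewrite <- E.
apply (is_lim_seq_continuous (fun d => 4 * sqrt ((C + 4 * sqrt C) * d)) delay 0).
- apply continuity_pt_of_continuous, continuous_Rmult; [apply continuous_Rconst|].
  apply (continuous_Rcomp (fun d => (C + 4 * sqrt C) * d) sqrt); [by_smoothness|apply continuous_sqrt].
- unfold delay. apply (is_lim_seq_incr_1 (fun n => / INR n)).
  replace (Finite 0) with (Rbar_inv p_infty) by reflexivity.
  apply is_lim_seq_inv; [apply is_lim_seq_INR|discriminate].
Qed.

Lemma eq_of_small (x y : R) (u : nat -> R) :
  is_lim_seq u 0 -> (forall n, Rabs (x - y) <= u n) -> x = y.
Proof.
intros hu h.
assert (H : Rbar_le (Rabs (x - y)) 0).
{ apply (is_lim_seq_le (fun _ => Rabs (x - y)) u); [exact h|apply is_lim_seq_const|exact hu]. }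
simpl in H. assert (h0 := Rabs_pos (x - y)).
destruct (Req_dec (x - y) 0) as [e|ne]; [lra|]. apply Rabs_pos_lt in ne. lra.
Qed.

(** Tonelli's scheme. Picard iteration would need a Lipschitz right-hand side,
    whereas the delayed equations are solved by plain integration; the bound on [G]
    gives their solutions a common Lipschitz constant. *)
Lemma backward_solution_exists (G : R -> R) (C : R) :
  (forall t, continuous G t) -> (forall t, 0 <= G t <= C) ->
  exists U : R -> R,
    (forall w, continuous U w) /\ U 1 = 0 /\
    (forall w, 0 < w < 1 -> is_derive U w (4 * sqrt (U w) - G w)).
Proof.
intros hG hC.
set (U := fun w => real (Lim_seq (fun n => tonelli G n w))).
assert (hlim : forall w, is_lim_seq (fun n => tonelli G n w) (U w)).
{ intros w. apply Lim_seq_correct'. apply ex_lim_seq_cauchy_corr.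
  intros e. assert (he := delay_error_lim C). apply is_lim_seq_spec in he.
  destruct (he (pos_div_2 e)) as [N hN]. exists N. intros n m hn hm.
  assert (h1 := hN n hn). assert (h2 := hN m hm). simpl in h1, h2.
  apply Rabs_def2 in h1. apply Rabs_def2 in h2.
  assert (h := tonelli_cauchy G C n m w hG hC). lra. }
assert (herr : forall n w, Rabs (tonelli G n w - U w) <= delay_error C n).
{ intros n w.
  assert (H : Rbar_le (Rabs (tonelli G n w - U w)) (delay_error C n + 0)).
  { apply (is_lim_seq_le (fun m => Rabs (tonelli G n w - tonelli G m w))
              (fun m => delay_error C n + delay_error C m)).
    - intros m. apply tonelli_cauchy; assumption.
    - apply (is_lim_seq_abs _ (tonelli G n w - U w)).
      apply is_lim_seq_minus'; [apply is_lim_seq_const|apply hlim].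
    - apply is_lim_seq_plus'; [apply is_lim_seq_const|apply delay_error_lim]. }
  simpl in H. lra. }
assert (hc : forall w, continuous U w).
{ apply (continuous_lipschitz U (C + 4 * sqrt C)). intros x y.
  assert (H : Rbar_le (Rabs (U x - U y)) ((C + 4 * sqrt C) * Rabs (x - y))).
  { apply (is_lim_seq_le (fun n => Rabs (tonelli G n x - tonelli G n y))
              (fun n => (C + 4 * sqrt C) * Rabs (x - y))).
    - intros n. apply tonelli_lipschitz; assumption.
    - apply (is_lim_seq_abs _ (U x - U y)). apply is_lim_seq_minus'; apply hlim.
    - apply is_lim_seq_const. }
  exact H. }
set (f := fun t => G t - 4 * sqrt (U t)).
assert (hf : forall t, continuous f t).
{ intros t. apply continuous_Rminus; [apply hG|]. apply continuous_Rmult; [apply continuous_Rconst|].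
  apply (continuous_Rcomp U sqrt); [apply hc|apply continuous_sqrt]. }
assert (heq : forall w, U w = RInt f (clamp w) 1).
{ intros w.
  apply (eq_of_small _ _ (fun n => delay_error C n + (delay_error C n + 4 * sqrt (delay_error C n)))).
  { replace (Finite 0) with (Finite (0 + (0 + 4 * sqrt 0))) by (rewrite sqrt_0; f_equal; ring).
    apply is_lim_seq_plus'; [apply delay_error_lim|].
    apply is_lim_seq_plus'; [apply delay_error_lim|].
    apply (is_lim_seq_continuous (fun x => 4 * sqrt x)); [|apply delay_error_lim].
    apply continuity_pt_of_continuous, continuous_Rmult; [apply continuous_Rconst|apply continuous_sqrt]. }
  intros n.
  set (fn := fun t => G t - 4 * sqrt (tonelli G n (t + delay n))).
  assert (hfn : forall t, continuous fn t).
  { apply delayed_integrand_continuous; [exact hG|apply delayed_continuous, hG]. }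
  assert (hi : forall a b, ex_RInt f a b)
    by (intros; apply (ex_RInt_continuous f); intros; apply hf).
  assert (hin : forall a b, ex_RInt fn a b)
    by (intros; apply (ex_RInt_continuous fn); intros; apply hfn).
  assert (hr := clamp_range w).
  replace (U w - RInt f (clamp w) 1) with
    ((U w - tonelli G n w) + RInt (fun t => fn t - f t) (clamp w) 1).
  2:{ rewrite (RInt_minus fn f) by auto. rewrite tonelli_equation. unfold minus, plus, opp; simpl.
      fold fn. ring. }
  apply Rle_trans with (1 := Rabs_triang _ _). apply Rplus_le_compat.
  { rewrite Rabs_minus_sym. apply herr. }
  set (E := delay_error C n + 4 * sqrt (delay_error C n)).
  assert (0 <= E).
  { unfold E, delay_error. assert (h1 := sqrt_pos ((C + 4 * sqrt C) * delay n)).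
    assert (h2 := sqrt_pos (4 * sqrt ((C + 4 * sqrt C) * delay n))). lra. }
  apply Rle_trans with ((1 - clamp w) * E); [|nra].
  apply abs_RInt_le_const; [lra|apply (ex_RInt_minus fn f); auto|].
  intros t _. unfold fn, f.
  replace (G t - 4 * sqrt (tonelli G n (t + delay n)) - (G t - 4 * sqrt (U t))) with
    (- (4 * sqrt (tonelli G n (t + delay n)) - 4 * sqrt (tonelli G n t))
     + - (4 * (sqrt (tonelli G n t) - sqrt (U t)))) by ring.
  apply Rle_trans with (1 := Rabs_triang _ _). rewrite !Rabs_Ropp.
  apply Rplus_le_compat; [apply delay_error_spec; assumption|].
  rewrite Rabs_mult, (Rabs_right 4) by lra. apply Rmult_le_compat_l; [lra|].
  apply Rle_trans with (1 := sqrt_diff_le _ _). apply sqrt_le_1_alt, herr. }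
exists U. split; [exact hc|split].
- rewrite heq, clamp_id by lra. exact (RInt_point 1 f).
- intros w hw. apply (is_derive_ext_loc (fun a => RInt f a 1)).
  + apply (locally_between _ 0 _ 1); [lra|]. intros y hy.
    rewrite heq, clamp_id by lra. reflexivity.
  + replace (4 * sqrt (U w) - G w) with (- f w) by (unfold f; ring).
    apply tail_integral_derive, hf.
Qed.

(** * Reaction terms and flux profiles *)

Lemma limit1_in_eps (h : R -> R) (D : R -> Prop) (l x : R) :
  limit1_in h D l x ->
  forall e, 0 < e -> exists d, 0 < d /\
    forall y, D y -> Rabs (y - x) < d -> Rabs (h y - l) < e.
Proof.
intros H e he. destruct (H e he) as [d [hd P]]. exists d; split; [exact hd|].
intros y hy hlt. apply (P y). split; assumption.
Qed.

Lemma continuous_clamp_of_relative (h : R -> R) :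
  (forall w, I01 w -> continue_in h I01 w) ->
  forall t, continuous (fun s => h (clamp s)) t.
Proof.
intros H t. apply continuous_eps. intros e he.
destruct (limit1_in_eps _ _ _ _ (H (clamp t) (clamp_range t)) e he) as [d [hd P]].
exists d; split; [exact hd|]. intros y hy.
destruct (Req_dec (clamp t) (clamp y)) as [E|ne].
- rewrite <- E, Rminus_diag, Rabs_R0. exact he.
- apply P; [split; [apply clamp_range|exact ne]|].
  apply Rle_lt_trans with (2 := hy), clamp_lipschitz.
Qed.

Lemma is_derive_of_relative (h h' : R -> R) (w : R) :
  0 < w < 1 -> D_in h h' I01 w -> is_derive h w (h' w).
Proof.
intros hw H. apply is_derive_Reals. intros e he.
destruct (limit1_in_eps _ _ _ _ H e he) as [d [hd P]].
assert (hm : 0 < Rmin d (Rmin w (1 - w))) by (repeat apply Rmin_glb_lt; lra).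
exists (mkposreal _ hm). intros k hk hlt. simpl in hlt.
assert (h1 := Rmin_l d (Rmin w (1 - w))). assert (h2 := Rmin_r d (Rmin w (1 - w))).
assert (h3 := Rmin_l w (1 - w)). assert (h4 := Rmin_r w (1 - w)).
assert (hlt' := hlt). apply Rabs_def2 in hlt'.
specialize (P (w + k)). replace (w + k - w) with k in P by ring.
apply P; [|lra]. split; [split; lra|lra].
Qed.

Lemma reaction_continuous (g g1 g2 : R -> R) :
  monostable g g1 g2 -> forall t, continuous (fun s => g (clamp s)) t.
Proof.
intros [H _]. apply continuous_clamp_of_relative. intros w hw.
apply (cont_deriv g g1 I01 w), H, hw.
Qed.

Lemma reaction_slope_continuous (g g1 g2 : R -> R) :
  monostable g g1 g2 -> forall t, continuous (fun s => g1 (clamp s)) t.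
Proof.
intros [H _]. apply continuous_clamp_of_relative. intros w hw.
apply (cont_deriv g1 g2 I01 w), H, hw.
Qed.

Lemma bounded_on_01 (h : R -> R) :
  (forall t, continuous (fun s => h (clamp s)) t) ->
  exists K, 0 < K /\ forall w, 0 <= w <= 1 -> Rabs (h w) <= K.
Proof.
intros hc.
destruct (continuity_ab_maj (fun t => Rabs (h (clamp t))) 0 1 ltac:(lra)) as [m [hm _]].
{ intros c _. apply continuity_pt_of_continuous.
  apply (continuous_Rcomp (fun s => h (clamp s)) Rabs); [apply hc|apply continuous_Rabs]. }
exists (Rabs (h (clamp m)) + 1). split; [assert (H := Rabs_pos (h (clamp m))); lra|].
intros w hw. specialize (hm w hw). simpl in hm. rewrite (clamp_id w) in hm by exact hw. lra.
Qed.

Lemma curvature_bounded (g g1 g2 : R -> R) :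
  monostable g g1 g2 -> exists K, 0 < K /\ forall w, I01 w -> Rabs (g2 w) <= K.
Proof.
intros [H _]. apply bounded_on_01, continuous_clamp_of_relative. intros w hw. apply H, hw.
Qed.

Lemma mean_value_reaction (h h' : R -> R) (a b : R) :
  (forall w, I01 w -> D_in h h' I01 w) ->
  0 <= a -> a < b -> b <= 1 ->
  exists c, a < c < b /\ h b - h a = h' c * (b - a).
Proof.
intros H ha hab hb.
destruct (mean_value (fun t => h (clamp t)) h' a b hab) as [c [hc E]].
- intros x _. apply continuous_clamp_of_relative. intros w hw.
  apply (cont_deriv h h' I01 w), H, hw.
- intros x hx. apply is_derive_ext_loc with h.
  + apply (locally_between _ 0 _ 1); [lra|]. intros y hy.
    rewrite clamp_id by lra. reflexivity.
  + apply is_derive_of_relative; [lra|]. apply H. split; lra.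
- exists c. split; [exact hc|]. rewrite !clamp_id in E by lra. exact E.
Qed.

Lemma reaction_taylor (g g1 g2 : R -> R) (K : R) :
  monostable g g1 g2 -> (forall w, I01 w -> Rabs (g2 w) <= K) ->
  forall w, 0 <= w <= 1 -> Rabs (g w - w) <= K * w * w.
Proof.
intros [H [h0 [_ [hs _]]]] hK w hw.
destruct (Req_dec w 0) as [->|ne]; [rewrite h0, Rminus_diag, Rabs_R0; lra|].
destruct (mean_value_reaction g g1 0 w) as [c [hc E]]; try lra; [intros; apply H; assumption|].
destruct (mean_value_reaction g1 g2 0 c) as [c' [hc' E']]; try lra; [intros; apply H; assumption|].
assert (hb := hK c' ltac:(split; lra)).
replace (g w - w) with (g2 c' * c * w).
2:{ rewrite h0, hs in *. replace (g1 c) with (1 + g2 c' * c) in E by lra. lra. }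
rewrite !Rabs_mult, (Rabs_right w), (Rabs_right c) by lra.
apply Rmult_le_compat_r; [lra|].
assert (0 <= Rabs (g2 c')) by apply Rabs_pos. nra.
Qed.

Lemma reaction_near_1 (g g1 g2 : R -> R) :
  monostable g g1 g2 ->
  exists K, 0 < K /\ forall w, 0 <= w <= 1 -> g w <= K * (1 - w).
Proof.
intros hg. destruct (bounded_on_01 g1 (reaction_slope_continuous _ _ _ hg)) as [K [hK B]].
exists K. split; [exact hK|]. intros w hw.
destruct hg as [H [_ [h1 _]]].
destruct (Req_dec w 1) as [->|ne]; [rewrite h1; lra|].
destruct (mean_value_reaction g g1 w 1) as [c [hc E]]; try lra; [intros; apply H; assumption|].
assert (hb := B c ltac:(lra)). apply Rabs_le_between in hb. rewrite h1 in E. nra.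
Qed.

Lemma reaction_nonneg (g g1 g2 : R -> R) :
  monostable g g1 g2 -> forall w, 0 <= w <= 1 -> 0 <= g w.
Proof.
intros [_ [h0 [h1 [_ [_ hp]]]]] w hw.
destruct (Req_dec w 0) as [->|n0]; [lra|]. destruct (Req_dec w 1) as [->|n1]; [lra|].
apply Rlt_le, hp. lra.
Qed.

(** What the wave equation at speed 2 becomes for [W' = - sqrt (U W)]. The condition
    [U 0 = 0] is left out: it is what decides whether there is a wave. *)
Definition flux_profile (g U : R -> R) : Prop :=
  (forall w, continuous U w) /\ U 1 = 0 /\
  (forall w, 0 < w < 1 -> is_derive U w (4 * sqrt (U w) - 2 * g w)).

Lemma flux_profile_exists (g g1 g2 : R -> R) :
  monostable g g1 g2 -> exists U, flux_profile g U.
Proof.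
intros hg. assert (hc := reaction_continuous _ _ _ hg).
destruct (bounded_on_01 g hc) as [K [hK B]].
destruct (backward_solution_exists (fun t => 2 * g (clamp t)) (2 * K)) as [U [h1 [h2 h3]]].
- intros t. apply continuous_Rmult; [apply continuous_Rconst|apply hc].
- intros t. assert (hb := B _ (clamp_range t)). apply Rabs_le_between in hb.
  assert (hn := reaction_nonneg _ _ _ hg _ (clamp_range t)). lra.
- exists U. split; [exact h1|split; [exact h2|]]. intros w hw.
  assert (h := h3 w hw). rewrite (clamp_id w) in h by lra. exact h.
Qed.

Lemma flux_profile_le (g h U V : R -> R) (e : R) :
  flux_profile g U -> flux_profile h V -> 0 <= e ->
  (forall w, 0 < w < 1 -> g w <= h w + e) ->
  forall w, 0 <= w <= 1 -> U w <= V w + 2 * e.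
Proof.
intros [cU [U1 dU]] [cV [V1 dV]] he hgh w hw.
apply Rle_trans with (V w + 2 * e * (1 - w)); [|nra].
apply (backward_comparison U V (fun w => 4 * sqrt (U w) - 2 * g w)
         (fun w => 4 * sqrt (V w) - 2 * h w)); try lra; auto.
- intros x hx. apply dU. lra.
- intros x hx. apply dV. lra.
- intros x hx hlt. assert (hs := sqrt_le_1_alt _ _ (Rlt_le _ _ hlt)).
  specialize (hgh x ltac:(lra)). lra.
Qed.

Lemma flux_profile_nonneg (g g1 g2 U : R -> R) :
  monostable g g1 g2 -> flux_profile g U -> forall w, 0 <= w <= 1 -> 0 <= U w.
Proof.
intros hg [cU [U1 dU]] w hw.
assert (H : 0 <= U w + 0 * (1 - w)); [|lra].
apply (backward_comparison (fun _ => 0) U (fun _ => 0) (fun w => 4 * sqrt (U w) - 2 * g w)); try lra; auto.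
- intros; apply continuous_Rconst.
- intros; apply (is_derive_const 0).
- intros x hx. apply dU. lra.
- intros x hx hlt. rewrite sqrt_neg_0 by lra.
  assert (h := reaction_nonneg _ _ _ hg x ltac:(lra)). lra.
Qed.

Lemma derive_zero_at_min (F : R -> R) (l a x b : R) :
  a < x < b -> is_derive F x l -> (forall y, a < y < b -> F x <= F y) -> l = 0.
Proof.
intros hx hd hm. apply is_derive_Reals in hd.
rewrite <- (proj2 (derive_pt_eq F x l (exist _ l hd)) hd).
apply (deriv_minimum F a b x); try lra. intros y h1 h2. apply hm. lra.
Qed.

(** An interior zero would be a minimum, but the slope there is [- 2 g w < 0]. *)
Lemma flux_profile_pos (g g1 g2 U : R -> R) :
  monostable g g1 g2 -> flux_profile g U -> forall w, 0 < w < 1 -> 0 < U w.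
Proof.
intros hg hU w hw. assert (hn := flux_profile_nonneg _ _ _ _ hg hU).
destruct (Req_dec (U w) 0) as [E|ne]; [exfalso|specialize (hn w ltac:(lra)); lra].
destruct hU as [_ [_ dU]].
assert (hd := dU w hw). rewrite E, sqrt_0 in hd.
assert (hg0 : 0 < g w) by (apply hg, hw).
assert (H := derive_zero_at_min U (4 * 0 - 2 * g w) 0 w 1 hw hd).
cut (4 * 0 - 2 * g w = 0); [lra|]. apply H.
intros y hy. rewrite E. apply hn. lra.
Qed.

(** * Travelling waves and their flux *)

Lemma wave_derive (g W : R -> R) (c : R) :
  traveling_wave g c W -> forall x, is_derive W x (Derive W x).
Proof. intros [H _] x. apply Derive_correct, H. Qed.

Lemma wave_derive2 (g W : R -> R) (c : R) :
  traveling_wave g c W ->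
  forall x, is_derive (Derive W) x (- c * Derive W x - g (W x)).
Proof.
intros [H [E _]] x. specialize (E x).
replace (- c * Derive W x - g (W x)) with (Derive (Derive W) x) by lra.
apply Derive_correct, H.
Qed.

Lemma wave_continuous (g W : R -> R) (c : R) :
  traveling_wave g c W -> forall x, continuous W x.
Proof. intros [H _] x. apply (ex_derive_continuous W), H. Qed.

Lemma wave_slope_continuous (g W : R -> R) (c : R) :
  traveling_wave g c W -> forall x, continuous (Derive W) x.
Proof. intros [H _] x. apply (ex_derive_continuous (Derive W)), H. Qed.

Lemma wave_decreasing (g W : R -> R) (c : R) :
  traveling_wave g c W -> forall x y, x < y -> W y < W x.
Proof.
intros hW x y hxy.
destruct (mean_value W (Derive W) x y hxy) as [z [_ E]].
- intros; apply (wave_continuous _ _ _ hW).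
- intros; apply (wave_derive _ _ _ hW).
- assert (h : Derive W z < 0) by apply hW. nra.
Qed.

Lemma wave_right_limit (g W : R -> R) (c : R) :
  traveling_wave g c W ->
  forall e, 0 < e -> exists X, forall x, X < x -> Rabs (W x) < e.
Proof.
intros [_ [_ [_ [H _]]]] e he. apply is_lim_spec in H.
destruct (H (mkposreal e he)) as [X hX]. exists X. intros x hx.
specialize (hX x hx). simpl in hX. rewrite Rminus_0_r in hX. exact hX.
Qed.

Lemma wave_left_limit (g W : R -> R) (c : R) :
  traveling_wave g c W ->
  forall e, 0 < e -> exists X, forall x, x < X -> Rabs (W x - 1) < e.
Proof.
intros [_ [_ [H _]]] e he. apply is_lim_spec in H.
destruct (H (mkposreal e he)) as [X hX]. exists X. exact hX.
Qed.

Lemma wave_range (g W : R -> R) (c : R) :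
  traveling_wave g c W -> forall x, 0 < W x < 1.
Proof.
intros hW x. assert (hd := wave_decreasing _ _ _ hW). split.
- destruct (Rlt_dec 0 (W x)) as [h|h]; [exact h|exfalso].
  assert (h1 := hd x (x + 1) ltac:(lra)).
  destruct (wave_right_limit _ _ _ hW (- W (x + 1)) ltac:(lra)) as [X hX].
  assert (hm := Rmax_l X (x + 1)). assert (hm' := Rmax_r X (x + 1)).
  specialize (hX (Rmax X (x + 1) + 1) ltac:(lra)). apply Rabs_def2 in hX.
  assert (h2 := hd (x + 1) (Rmax X (x + 1) + 1) ltac:(lra)). lra.
- destruct (Rlt_dec (W x) 1) as [h|h]; [exact h|exfalso].
  assert (h1 := hd (x - 1) x ltac:(lra)).
  destruct (wave_left_limit _ _ _ hW (W (x - 1) - 1) ltac:(lra)) as [X hX].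
  assert (hm := Rmin_l X (x - 1)). assert (hm' := Rmin_r X (x - 1)).
  specialize (hX (Rmin X (x - 1) - 1) ltac:(lra)). apply Rabs_def2 in hX.
  assert (h2 := hd (Rmin X (x - 1) - 1) (x - 1) ltac:(lra)). lra.
Qed.

Lemma wave_onto (g W : R -> R) (c w : R) :
  traveling_wave g c W -> 0 < w < 1 -> exists x, W x = w.
Proof.
intros hW hw.
destruct (wave_right_limit _ _ _ hW w ltac:(lra)) as [X hX].
destruct (wave_left_limit _ _ _ hW (1 - w) ltac:(lra)) as [Y hY].
specialize (hX (X + 1) ltac:(lra)). specialize (hY (Y - 1) ltac:(lra)).
apply Rabs_def2 in hX. apply Rabs_def2 in hY.
destruct (IVT_gen W (Y - 1) (X + 1) w) as [x [_ E]].
- intros x. apply continuity_pt_of_continuous, (wave_continuous _ _ _ hW).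
- unfold Rmin, Rmax; repeat destruct Rle_dec; lra.
- exists x. exact E.
Qed.

Lemma wave_eventually_below (g W : R -> R) (c e : R) :
  traveling_wave g c W -> 0 < e -> exists X, forall x, X <= x -> W x < e.
Proof.
intros hW he. destruct (wave_right_limit _ _ _ hW e he) as [X hX].
exists (X + 1). intros x hx. specialize (hX x ltac:(lra)). apply Rabs_def2 in hX. lra.
Qed.

(** [W' + c W] is nonincreasing because the reaction is nonnegative; were it ever
    negative, [W] would eventually decrease linearly. *)
Lemma wave_slope_lower (g g1 g2 W : R -> R) (c : R) :
  monostable g g1 g2 -> traveling_wave g c W ->
  forall x, 0 <= Derive W x + c * W x.
Proof.
intros hg hW x0. destruct (Rle_dec 0 (Derive W x0 + c * W x0)) as [h|h]; [exact h|exfalso].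
apply Rnot_le_lt in h. set (m := - (Derive W x0 + c * W x0)) in *.
assert (hr := wave_range _ _ _ hW).
assert (hmono : forall x, x0 <= x -> Derive W x + c * W x <= - m).
{ intros x hx.
  assert (H : - (Derive W x0 + c * W x0) <= - (Derive W x + c * W x)); [|unfold m; lra].
  apply (nondecreasing_of_derive (fun x => - (Derive W x + c * W x)) (fun x => g (W x)) x0 x hx).
  - intros y _. apply (continuous_Rcomp (fun x => Derive W x + c * W x) Ropp); [|by_smoothness].
    apply continuous_Rplus; [apply (wave_slope_continuous _ _ _ hW)|].
    apply continuous_Rmult; [apply continuous_Rconst|apply (wave_continuous _ _ _ hW)].
  - intros y _. assert (h1 := wave_derive _ _ _ hW y). assert (h2 := wave_derive2 _ _ _ hW y).
    auto_derive; [repeat split; eexists; eassumption|].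
    change (fun x => W x) with W. change (fun x => Derive W x) with (Derive W).
    rewrite (is_derive_unique _ _ _ h2). ring.
  - intros y _. apply (reaction_nonneg _ _ _ hg). specialize (hr y). lra. }
assert (hc : 0 < Rabs c + 1) by (assert (H := Rabs_pos c); lra).
destruct (wave_eventually_below _ _ _ (m / (2 * (Rabs c + 1))) hW) as [X hX].
{ apply Rdiv_lt_0_compat; unfold m in *; lra. }
set (a := Rmax X x0). assert (ha : X <= a) by apply Rmax_l. assert (ha' : x0 <= a) by apply Rmax_r.
assert (hslope : forall x, a <= x -> Derive W x <= - (m / 2)).
{ intros x hx. specialize (hmono x ltac:(lra)). specialize (hX x ltac:(lra)). specialize (hr x).
  assert (hmul : (Rabs c + 1) * W x <= m / 2).
  { apply Rle_trans with ((Rabs c + 1) * (m / (2 * (Rabs c + 1)))).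
    - apply Rmult_le_compat_l; lra.
    - apply Req_le. field. lra. }
  assert (- c * W x <= (Rabs c + 1) * W x).
  { apply Rmult_le_compat_r; [lra|]. assert (H := Rabs_maj2 c). lra. }
  lra. }
set (b := a + 2 / m).
assert (hmpos : 0 < m) by (unfold m in *; lra).
assert (hb : a < b) by (unfold b; assert (0 < 2 / m) by (apply Rdiv_lt_0_compat; lra); lra).
destruct (mean_value W (Derive W) a b hb) as [z [hz E]].
- intros; apply (wave_continuous _ _ _ hW).
- intros; apply (wave_derive _ _ _ hW).
- specialize (hslope z ltac:(lra)).
  assert (Derive W z * (b - a) <= - (m / 2) * (b - a)) by (apply Rmult_le_compat_r; lra).
  replace (- (m / 2) * (b - a)) with (- 1) in H by (unfold b; field; lra).
  assert (h1 := hr a). assert (h2 := hr b). lra.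
Qed.

(** A stand-in for the limits of [W'] at infinity. *)
Lemma wave_flat_between (g W : R -> R) (c e a : R) :
  traveling_wave g c W -> 0 < e -> exists x, a < x < a + / e /\ Rabs (Derive W x) < e.
Proof.
intros hW he. assert (hi := Rinv_0_lt_compat _ he).
destruct (mean_value W (Derive W) a (a + / e) ltac:(lra)) as [z [hz E]].
- intros; apply (wave_continuous _ _ _ hW).
- intros; apply (wave_derive _ _ _ hW).
- exists z. split; [exact hz|].
  assert (h1 := wave_range _ _ _ hW a). assert (h2 := wave_range _ _ _ hW (a + / e)).
  replace (a + / e - a) with (/ e) in E by ring.
  replace (Derive W z) with ((W (a + / e) - W a) * e) by (rewrite E; field; lra).
  rewrite Rabs_mult, (Rabs_right e) by lra.
  assert (Rabs (W (a + / e) - W a) < 1) by (apply Rabs_def1; lra). nra.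
Qed.

Lemma wave_logslope_derive (g W : R -> R) (c : R) :
  traveling_wave g c W -> forall x,
  is_derive (fun x => - Derive W x / W x) x
    ((- Derive W x / W x) * (- Derive W x / W x) - c * (- Derive W x / W x) + g (W x) / W x).
Proof.
intros hW x. assert (hr := wave_range _ _ _ hW x).
assert (h1 := wave_derive _ _ _ hW x). assert (h2 := wave_derive2 _ _ _ hW x).
auto_derive.
- repeat split; try (eexists; eassumption). lra.
- change (fun x => W x) with W. change (fun x => Derive W x) with (Derive W).
  rewrite (is_derive_unique _ _ _ h2). field. lra.
Qed.

Lemma wave_logslope_continuous (g W : R -> R) (c : R) :
  traveling_wave g c W -> forall x, continuous (fun x => - Derive W x / W x) x.
Proof.
intros hW x. apply (ex_derive_continuous (fun x => - Derive W x / W x)).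
eexists. apply (wave_logslope_derive _ _ _ hW).
Qed.

Lemma wave_logslope_bounds (g g1 g2 W : R -> R) (c : R) :
  monostable g g1 g2 -> traveling_wave g c W ->
  forall x, 0 < - Derive W x / W x <= c.
Proof.
intros hg hW x. assert (hr := wave_range _ _ _ hW x).
assert (hl := wave_slope_lower _ _ _ _ _ hg hW x).
assert (hn : Derive W x < 0) by apply hW. split.
- apply Rdiv_lt_0_compat; lra.
- apply Rmult_le_reg_r with (W x); [lra|]. replace (- Derive W x / W x * W x) with (- Derive W x) by (field; lra). lra.
Qed.

(** For [c < 2] the Riccati equation of the logarithmic slope has no equilibrium
    near [W = 0], so that slope would leave its bounded range. *)
Lemma wave_speed_ge_2 (g g1 g2 W : R -> R) (c : R) :
  monostable g g1 g2 -> traveling_wave g c W -> 2 <= c.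
Proof.
intros hg hW. destruct (Rle_dec 2 c) as [h|h]; [exact h|exfalso]. apply Rnot_le_lt in h.
assert (hq := wave_logslope_bounds _ _ _ _ _ hg hW).
assert (hr := wave_range _ _ _ hW).
assert (hc : 0 < c) by (specialize (hq 0); lra).
destruct (curvature_bounded _ _ _ hg) as [K [hK B]].
set (eta := (1 - c * c / 4) / 2).
assert (heta : 0 < eta) by (unfold eta; nra).
destruct (wave_eventually_below _ _ _ (eta / K) hW) as [X hX]; [apply Rdiv_lt_0_compat; lra|].
set (q := fun x => - Derive W x / W x) in *.
set (b := X + c / eta).
assert (hb : 0 < c / eta) by (apply Rdiv_lt_0_compat; lra).
assert (H : q X - eta * X <= q b - eta * b).
{ apply (nondecreasing_of_derive (fun x => q x - eta * x)
    (fun x => q x * q x - c * q x + g (W x) / W x - eta) X b); [unfold b; lra| | |].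
  - intros x _. apply continuous_Rminus; [apply (wave_logslope_continuous _ _ _ hW)|by_smoothness].
  - intros x _. apply (is_derive_minus q (fun x => eta * x)); [apply (wave_logslope_derive _ _ _ hW)|].
    auto_derive; [exact I|ring].
  - intros x hx. specialize (hX x ltac:(lra)). specialize (hr x).
    assert (ht := reaction_taylor _ _ _ K hg B (W x) ltac:(lra)).
    apply Rabs_le_between in ht.
    assert (hh : 1 - eta <= g (W x) / W x).
    { apply Rmult_le_reg_r with (W x); [lra|].
      replace (g (W x) / W x * W x) with (g (W x)) by (field; lra).
      assert (K * W x <= eta).
      { apply Rle_trans with (K * (eta / K)); [nra|]. apply Req_le; field; lra. }
      nra. }
    assert (0 <= (q x - c / 2) * (q x - c / 2)) by apply Rle_0_sqr.
    unfold eta in *. nra. }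
assert (h1 := hq X). assert (h2 := hq b). fold (q X) in h1. fold (q b) in h2.
unfold b in H at 2. replace (eta * (X + c / eta)) with (eta * X + c) in H by (field; lra). unfold q in *. lra.
Qed.

(** [phi = W' ^ 2 - U (W)] satisfies [phi' = - 4 W' (W' + sqrt (U W))], which has
    the sign opposite to [phi]; so [phi ^ 2] is nonincreasing, and it is small at
    arbitrarily negative positions. *)
Lemma wave_flux (g g1 g2 U W : R -> R) :
  monostable g g1 g2 -> flux_profile g U -> traveling_wave g 2 W ->
  forall x, Derive W x * Derive W x = U (W x).
Proof.
intros hg hU hW x0.
assert (hr := wave_range _ _ _ hW).
set (phi := fun x => Derive W x * Derive W x - U (W x)).
set (dphi := fun x => - 4 * Derive W x * (Derive W x + sqrt (U (W x)))).
assert (hUn := flux_profile_nonneg _ _ _ _ hg hU).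
destruct hU as [cU [U1 dU]].
assert (hd : forall x, is_derive phi x (dphi x)).
{ intros x. assert (h1 := wave_derive _ _ _ hW x). assert (h2 := wave_derive2 _ _ _ hW x).
  assert (h3 := dU (W x) (hr x)).
  unfold phi, dphi. auto_derive.
  - repeat split; eexists; eassumption.
  - change (fun x => W x) with W. change (fun x => U x) with U. change (fun x => Derive W x) with (Derive W).
    rewrite (is_derive_unique _ _ _ h2), (is_derive_unique _ _ _ h3). ring. }
assert (hpc : forall x, continuous phi x).
{ intros x. apply (ex_derive_continuous phi). eexists. apply hd. }
assert (hmono : forall x, x <= x0 -> phi x0 * phi x0 <= phi x * phi x).
{ intros x hx.
  assert (H : - (phi x * phi x) <= - (phi x0 * phi x0)); [|lra].
  apply (nondecreasing_of_derive (fun y => - (phi y * phi y)) (fun y => - (2 * phi y * dphi y)) x x0 hx).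
  - intros y _. apply (continuous_Rcomp (fun y => phi y * phi y) Ropp); [|by_smoothness].
    apply continuous_Rmult; apply hpc.
  - intros y _. assert (h := hd y). auto_derive; [repeat split; eexists; eassumption|].
    change (fun x => phi x) with phi. rewrite (is_derive_unique _ _ _ h). ring.
  - intros y _. unfold phi, dphi. specialize (hr y). assert (hn : Derive W y < 0) by apply hW.
    specialize (hUn (W y) ltac:(lra)).
    assert (hs := sqrt_sqrt _ hUn). assert (hp := sqrt_pos (U (W y))).
    set (p := sqrt (U (W y))) in *. rewrite <- hs.
    set (d := Derive W y) in *.
    replace (- (2 * (d * d - p * p) * (-4 * d * (d + p)))) with
      (8 * (- d) * ((p - d) * ((d + p) * (d + p)))) by ring.
    apply Rmult_le_pos; [lra|]. apply Rmult_le_pos; [lra|apply Rle_0_sqr]. }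
destruct (Req_dec (phi x0) 0) as [E|ne]; [unfold phi in E; lra|exfalso].
assert (hpos : 0 < Rabs (phi x0)) by (apply Rabs_pos_lt, ne).
set (e := Rabs (phi x0)) in *.
destruct (proj1 (continuous_eps U 1) (cU 1) (e / 2) ltac:(lra)) as [d [hdp hUd]].
destruct (wave_left_limit _ _ _ hW d hdp) as [X hX].
set (r := Rmin 1 (e / 2)).
assert (hrp : 0 < r) by (apply Rmin_glb_lt; lra).
assert (hr1 : r <= 1) by apply Rmin_l. assert (hr2 : r <= e / 2) by apply Rmin_r.
destruct (wave_flat_between _ _ _ r (Rmin X x0 - / r) hW hrp) as [x [hx hflat]].
assert (hx1 := Rmin_l X x0). assert (hx2 := Rmin_r X x0).
specialize (hX x ltac:(lra)). specialize (hUd (W x) hX). rewrite U1, Rminus_0_r in hUd.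
specialize (hmono x ltac:(lra)).
assert (hsmall : Rabs (phi x) < e).
{ unfold phi. apply Rle_lt_trans with (1 := Rabs_triang _ _). rewrite Rabs_Ropp, Rabs_mult.
  assert (h0 := Rabs_pos (Derive W x)). nra. }
assert (hsq : forall y, phi y * phi y = Rabs (phi y) * Rabs (phi y)).
{ intros y. rewrite <- Rabs_mult. symmetry. apply Rabs_right, Rle_ge, Rle_0_sqr. }
rewrite !hsq in hmono. fold e in hmono. assert (h0 := Rabs_pos (phi x)). nra.
Qed.

(** Far to the right there are points where [W] and [W'] are both small. *)
Lemma wave_flux_at_0 (g g1 g2 U W : R -> R) :
  monostable g g1 g2 -> flux_profile g U -> traveling_wave g 2 W -> U 0 = 0.
Proof.
intros hg hU hW. assert (hf := wave_flux _ _ _ _ _ hg hU hW).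
destruct hU as [cU _].
destruct (Req_dec (U 0) 0) as [E|ne]; [exact E|exfalso].
apply Rabs_pos_lt in ne. set (e := Rabs (U 0)) in *.
destruct (proj1 (continuous_eps U 0) (cU 0) (e / 2) ltac:(lra)) as [d [hdp hUd]].
destruct (wave_right_limit _ _ _ hW d hdp) as [X hX].
set (r := Rmin 1 (e / 2)).
assert (hrp : 0 < r) by (apply Rmin_glb_lt; lra).
assert (hr1 : r <= 1) by apply Rmin_l. assert (hr2 : r <= e / 2) by apply Rmin_r.
destruct (wave_flat_between _ _ _ r X hW hrp) as [x [hx hflat]].
specialize (hX x ltac:(lra)). specialize (hUd (W x)). rewrite Rminus_0_r in hUd. specialize (hUd hX).
assert (h1 : e <= Rabs (U (W x)) + Rabs (U (W x) - U 0)).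
{ unfold e. replace (U 0) with (U (W x) + - (U (W x) - U 0)) at 1 by ring.
  apply Rle_trans with (1 := Rabs_triang _ _). rewrite Rabs_Ropp. lra. }
rewrite <- (hf x) in h1 at 1. rewrite Rabs_mult in h1.
assert (h0 := Rabs_pos (Derive W x)). nra.
Qed.

Lemma wave_slope (g g1 g2 U W : R -> R) :
  monostable g g1 g2 -> flux_profile g U -> traveling_wave g 2 W ->
  forall x, - Derive W x = sqrt (U (W x)).
Proof.
intros hg hU hW x. rewrite <- (wave_flux _ _ _ _ _ hg hU hW x).
assert (hn : Derive W x < 0) by apply hW.
replace (Derive W x * Derive W x) with ((- Derive W x) * (- Derive W x)) by ring.
symmetry. apply sqrt_square. lra.
Qed.

(** * A wave from a profile vanishing at both ends *)

(** The position at which the orbit of [W' = - P W] that starts from height [/ 2] at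
    position 0 reaches height [w]; the wave is the inverse function. *)
Definition travel_time (P : R -> R) (w : R) : R := RInt (fun t => / P t) w (/ 2).

Lemma travel_time_derive (P : R -> R) (w : R) :
  (forall t, continuous P t) -> (forall t, 0 < t < 1 -> 0 < P t) ->
  0 < w < 1 -> is_derive (travel_time P) w (- / P w).
Proof.
intros hc hP hw.
assert (hci : forall t, 0 < t < 1 -> continuous (fun t => / P t) t).
{ intros t ht. apply (continuous_Rcomp P Rinv); [apply hc|].
  apply (ex_derive_continuous Rinv). auto_derive. assert (h := hP t ht). lra. }
apply (is_derive_RInt' (fun t => / P t) (travel_time P) w (/ 2)); [|apply hci, hw].
apply (locally_between _ 0 _ 1); [lra|]. intros y hy.
apply (RInt_correct (fun t => / P t)), (ex_RInt_continuous (fun t => / P t)).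
intros z hz. apply hci.
assert (h1 := Rmin_glb_lt y (/ 2) 0 ltac:(lra) ltac:(lra)).
assert (h2 := Rmax_lub_lt y (/ 2) 1 ltac:(lra) ltac:(lra)). lra.
Qed.

Lemma travel_time_continuous (P : R -> R) (w : R) :
  (forall t, continuous P t) -> (forall t, 0 < t < 1 -> 0 < P t) ->
  0 < w < 1 -> continuous (travel_time P) w.
Proof.
intros hc hP hw. apply (ex_derive_continuous (travel_time P)).
eexists. apply travel_time_derive; assumption.
Qed.

Lemma travel_time_antitone (P : R -> R) (v w : R) :
  (forall t, continuous P t) -> (forall t, 0 < t < 1 -> 0 < P t) ->
  0 < v -> v <= w -> w < 1 -> travel_time P w <= travel_time P v.
Proof.
intros hc hP hv hvw hw.
assert (H : - travel_time P v <= - travel_time P w); [|lra].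
apply (nondecreasing_of_derive (fun t => - travel_time P t) (fun t => / P t) v w hvw).
- intros x hx. apply (continuous_Rcomp (travel_time P) Ropp); [|by_smoothness].
  apply travel_time_continuous; [assumption|assumption|lra].
- intros x hx. replace (/ P x) with (- - / P x) by ring.
  apply (is_derive_opp (travel_time P)). apply travel_time_derive; [assumption|assumption|lra].
- intros x hx. apply Rlt_le, Rinv_0_lt_compat, hP. lra.
Qed.

Lemma travel_time_near_0 (P : R -> R) (m w : R) :
  (forall t, continuous P t) -> (forall t, 0 < t < 1 -> 0 < P t) ->
  0 < m -> (forall t, 0 < t < 1 -> P t <= m * t) ->
  0 < w <= / 2 -> (ln (/ 2) - ln w) / m <= travel_time P w.
Proof.
intros hc hP hm hb hw.
assert (h0 : travel_time P (/ 2) = 0) by (exact (RInt_point (/ 2) (fun t => / P t))).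
assert (H : - travel_time P w - ln w / m <= - travel_time P (/ 2) - ln (/ 2) / m).
2:{ rewrite h0 in H. unfold Rdiv in *. rewrite Rmult_minus_distr_r. lra. }
apply (nondecreasing_of_derive (fun t => - travel_time P t - ln t / m)
  (fun t => / P t - / (m * t)) w (/ 2)); [lra| | |].
- intros x hx. apply continuous_Rminus; [|by_smoothness; lra].
  apply (continuous_Rcomp (travel_time P) Ropp); [|by_smoothness].
  apply travel_time_continuous; [assumption|assumption|lra].
- intros x hx. apply (is_derive_minus (fun t => - travel_time P t) (fun t => ln t / m)).
  + replace (/ P x) with (- - / P x) by ring.
    apply (is_derive_opp (travel_time P)). apply travel_time_derive; [assumption|assumption|lra].
  + auto_derive; [lra|]. field. lra.
- intros x hx. assert (h1 := hP x ltac:(lra)). specialize (hb x ltac:(lra)).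
  assert (h2 := Rinv_le_contravar _ _ h1 hb). lra.
Qed.

Lemma travel_time_near_1 (P : R -> R) (m w : R) :
  (forall t, continuous P t) -> (forall t, 0 < t < 1 -> 0 < P t) ->
  0 < m -> (forall t, 0 < t < 1 -> P t <= m * (1 - t)) ->
  / 2 <= w < 1 -> travel_time P w <= (ln (1 - w) - ln (/ 2)) / m.
Proof.
intros hc hP hm hb hw.
assert (h0 : travel_time P (/ 2) = 0) by (exact (RInt_point (/ 2) (fun t => / P t))).
assert (H : - travel_time P (/ 2) + ln (1 - / 2) / m <= - travel_time P w + ln (1 - w) / m).
2:{ rewrite h0 in H. replace (1 - / 2) with (/ 2) in H by lra. unfold Rdiv in *. rewrite Rmult_minus_distr_r. lra. }
apply (nondecreasing_of_derive (fun t => - travel_time P t + ln (1 - t) / m)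
  (fun t => / P t + - / (m * (1 - t))) (/ 2) w); [lra| | |].
- intros x hx. apply continuous_Rplus; [|by_smoothness; lra].
  apply (continuous_Rcomp (travel_time P) Ropp); [|by_smoothness].
  apply travel_time_continuous; [assumption|assumption|lra].
- intros x hx. apply (is_derive_plus (fun t => - travel_time P t) (fun t => ln (1 - t) / m)).
  + replace (/ P x) with (- - / P x) by ring.
    apply (is_derive_opp (travel_time P)). apply travel_time_derive; [assumption|assumption|lra].
  + auto_derive; [lra|]. field. lra.
- intros x hx. assert (h1 := hP x ltac:(lra)). specialize (hb x ltac:(lra)).
  assert (h2 := Rinv_le_contravar _ _ h1 hb). lra.
Qed.

(** A sigma type, so that the inverse function is obtained by projection. *)
Lemma travel_time_onto (P : R -> R) (m : R) :
  (forall t, continuous P t) -> (forall t, 0 < t < 1 -> 0 < P t) ->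
  0 < m -> (forall t, 0 < t < 1 -> P t <= m * t) ->
  (forall t, 0 < t < 1 -> P t <= m * (1 - t)) ->
  forall x, {w | 0 < w < 1 /\ travel_time P w = x}.
Proof.
intros hc hP hm hb0 hb1 x.
set (r := / 2 * exp (- (m * (Rabs x + 1)))).
assert (hx := Rabs_pos x).
assert (hr : 0 < r < / 2).
{ unfold r. assert (h := exp_pos (- (m * (Rabs x + 1)))).
  assert (exp (- (m * (Rabs x + 1))) < 1).
  { rewrite <- exp_0 at 2. apply exp_increasing.
    assert (0 < m * (Rabs x + 1)) by (apply Rmult_lt_0_compat; lra). lra. }
  lra. }
assert (hln : ln r = ln (/ 2) - m * (Rabs x + 1)).
{ unfold r. rewrite ln_mult by (first [apply exp_pos | lra]). rewrite ln_exp. ring. }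
assert (h0 := travel_time_near_0 P m r hc hP hm hb0 ltac:(lra)).
assert (h1 := travel_time_near_1 P m (1 - r) hc hP hm hb1 ltac:(lra)).
replace (1 - (1 - r)) with r in h1 by ring. rewrite hln in h0, h1.
replace ((ln (/ 2) - (ln (/ 2) - m * (Rabs x + 1))) / m) with (Rabs x + 1) in h0 by (field; lra).
replace ((ln (/ 2) - m * (Rabs x + 1) - ln (/ 2)) / m) with (- (Rabs x + 1)) in h1 by (field; lra).
assert (ha := Rle_abs x). assert (ha' := Rle_abs (- x)). rewrite Rabs_Ropp in ha'.
destruct (IVT_interv (fun w => x - travel_time P w) r (1 - r)) as [w [hw E]].
- intros a h. apply continuity_pt_of_continuous.
  apply continuous_Rminus; [apply continuous_Rconst|].
  apply travel_time_continuous; [assumption|assumption|lra].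
- lra.
- lra.
- lra.
- exists w. split; lra.
Qed.

(** The linear bounds on [P] make the travel time diverge logarithmically at both
    ends, so the orbit is defined on the whole line and joins 1 to 0. *)
Lemma descending_orbit_exists (P : R -> R) (m : R) :
  (forall t, continuous P t) -> (forall t, 0 < t < 1 -> 0 < P t) ->
  0 < m -> (forall t, 0 < t < 1 -> P t <= m * t) ->
  (forall t, 0 < t < 1 -> P t <= m * (1 - t)) ->
  exists W, (forall x, 0 < W x < 1) /\ (forall x, is_derive W x (- P (W x))) /\
    is_lim W m_infty 1 /\ is_lim W p_infty 0.
Proof.
intros hc hP hm hb0 hb1.
set (T := travel_time_onto P m hc hP hm hb0 hb1).
set (W := fun x => proj1_sig (T x)).
assert (hr : forall x, 0 < W x < 1) by (intros x; exact (proj1 (proj2_sig (T x)))).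
assert (hT : forall x, travel_time P (W x) = x) by (intros x; exact (proj2 (proj2_sig (T x)))).
clearbody W. clear T.
assert (hmv : forall x y, W x <= W y -> exists z, W x <= z <= W y /\ W y - W x = - P z * (y - x)).
{ intros x y h. destruct (Req_dec (W x) (W y)) as [E|ne].
  - exists (W x). split; [lra|]. replace y with x; [rewrite E; ring|].
    rewrite <- (hT x), <- (hT y), E. reflexivity.
  - assert (hx := hr x). assert (hy := hr y).
    destruct (mean_value (travel_time P) (fun w => - / P w) (W x) (W y)) as [z [hz E]].
    + lra.
    + intros t ht. apply travel_time_continuous; [assumption|assumption|lra].
    + intros t ht. apply travel_time_derive; [assumption|assumption|lra].
    + exists z. split; [lra|]. rewrite !hT in E. rewrite E. field.
      assert (0 < P z) by (apply hP; lra). lra. }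
assert (hmv' : forall x y, exists z, Rabs (z - W x) <= m * Rabs (y - x) /\ W y - W x = - P z * (y - x)).
{ intros x y.
  assert (hz : exists z, Rabs (z - W x) <= Rabs (W y - W x) /\ 0 < z < 1 /\ W y - W x = - P z * (y - x)).
  { assert (hx := hr x). assert (hy := hr y).
    destruct (Rle_dec (W x) (W y)) as [h|h].
    - destruct (hmv x y h) as [z [hz E]]. exists z. split; [|split; [lra|exact E]].
      rewrite !Rabs_right by lra. lra.
    - destruct (hmv y x ltac:(lra)) as [z [hz E]]. exists z. split; [|split; [lra|lra]].
      rewrite !Rabs_left1 by lra. lra. }
  destruct hz as [z [h1 [h2 E]]]. exists z. split; [|exact E].
  apply Rle_trans with (1 := h1). rewrite E, Rabs_mult, Rabs_Ropp.
  apply Rmult_le_compat_r; [apply Rabs_pos|].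
  assert (h3 := hP z h2). rewrite Rabs_right by lra. specialize (hb0 z h2). nra. }
exists W. split; [exact hr|split; [|split]].
- intros x. apply is_derive_Reals. intros e he.
  destruct (proj1 (continuous_eps P (W x)) (hc (W x)) e he) as [d [hd hPd]].
  assert (hdm : 0 < d / m) by (apply Rdiv_lt_0_compat; assumption).
  exists (mkposreal _ hdm). intros h hne hlt. simpl in hlt.
  destruct (hmv' x (x + h)) as [z [hz E]]. replace (x + h - x) with h in * by ring.
  rewrite E. replace (- P z * h / h - - P (W x)) with (- (P z - P (W x))) by (field; exact hne).
  rewrite Rabs_Ropp. apply hPd. apply Rle_lt_trans with (1 := hz).
  apply Rmult_lt_reg_r with (/ m); [apply Rinv_0_lt_compat, hm|].
  replace (m * Rabs h * / m) with (Rabs h) by (field; lra). exact hlt.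
- apply is_lim_spec. intros e.
  set (w := Rmax (/ 2) (1 - e / 2)).
  assert (he := cond_pos e). assert (h1 := Rmax_l (/ 2) (1 - e / 2)). assert (h2 := Rmax_r (/ 2) (1 - e / 2)).
  assert (h3 : w < 1) by (apply Rmax_lub_lt; lra). fold w in h1, h2.
  exists (travel_time P w). intros x hx. specialize (hr x).
  destruct (Rle_dec (W x) w) as [h|h].
  + assert (H := travel_time_antitone P (W x) w hc hP ltac:(lra) h h3). rewrite hT in H. lra.
  + apply Rabs_def1; lra.
- apply is_lim_spec. intros e.
  set (w := Rmin (/ 2) (e / 2)).
  assert (he := cond_pos e). assert (h1 := Rmin_l (/ 2) (e / 2)). assert (h2 := Rmin_r (/ 2) (e / 2)).
  assert (h3 : 0 < w) by (apply Rmin_glb_lt; lra). fold w in h1, h2.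
  exists (travel_time P w). intros x hx. specialize (hr x).
  destruct (Rle_dec w (W x)) as [h|h].
  + assert (H := travel_time_antitone P w (W x) hc hP h3 h ltac:(lra)). rewrite hT in H. lra.
  + rewrite Rminus_0_r. apply Rabs_def1; lra.
Qed.

Lemma sqrt_flux_continuous (g U : R -> R) :
  flux_profile g U -> forall w, continuous (fun w => sqrt (U w)) w.
Proof. intros [cU _] w. apply (continuous_Rcomp U sqrt); [apply cU|apply continuous_sqrt]. Qed.

Lemma sqrt_flux_derive (g g1 g2 U : R -> R) :
  monostable g g1 g2 -> flux_profile g U ->
  forall w, 0 < w < 1 -> is_derive (fun w => sqrt (U w)) w (2 - g w / sqrt (U w)).
Proof.
intros hg hU w hw. assert (hp := flux_profile_pos _ _ _ _ hg hU w hw).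
assert (hs := sqrt_lt_R0 _ hp). destruct hU as [_ [_ dU]]. specialize (dU w hw).
auto_derive; [repeat split; try (eexists; eassumption); assumption|].
change (fun x => U x) with U. rewrite (is_derive_unique _ _ _ dU). field. lra.
Qed.

(** The slope of [sqrt U] is [2 - g / sqrt U < 2]. *)
Lemma sqrt_flux_le_left (g g1 g2 U : R -> R) :
  monostable g g1 g2 -> flux_profile g U -> U 0 = 0 ->
  forall w, 0 < w < 1 -> sqrt (U w) <= 2 * w.
Proof.
intros hg hU U0 w hw.
destruct (mean_value (fun w => sqrt (U w)) (fun w => 2 - g w / sqrt (U w)) 0 w) as [c [hc E]].
- lra.
- intros; apply (sqrt_flux_continuous _ _ hU).
- intros x hx. apply (sqrt_flux_derive _ _ _ _ hg hU). lra.
- rewrite U0, sqrt_0 in E.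
  assert (0 < g c / sqrt (U c)).
  { apply Rdiv_lt_0_compat; [apply hg; lra|]. apply sqrt_lt_R0, (flux_profile_pos _ _ _ _ hg hU). lra. }
  nra.
Qed.

(** [K (1 - w) ^ 2] is a supersolution when [g w <= K (1 - w)]. *)
Lemma sqrt_flux_le_right (g g1 g2 U : R -> R) :
  monostable g g1 g2 -> flux_profile g U ->
  exists m, 0 < m /\ forall w, 0 < w < 1 -> sqrt (U w) <= m * (1 - w).
Proof.
intros hg [cU [U1 dU]].
destruct (reaction_near_1 _ _ _ hg) as [K [hK B]].
exists (sqrt K). split; [apply sqrt_lt_R0, hK|]. intros w hw.
assert (H : U w <= K * ((1 - w) * (1 - w)) + 0 * (1 - w)).
{ apply (backward_comparison U (fun w => K * ((1 - w) * (1 - w))) 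
    (fun w => 4 * sqrt (U w) - 2 * g w) (fun w => - 2 * K * (1 - w))); try lra; auto.
  - intros x _. by_smoothness.
  - intros x hx. apply dU. lra.
  - intros x hx. auto_derive; [exact I|ring].
  - intros x hx _. assert (h := sqrt_pos (U x)). specialize (B x ltac:(lra)). lra. }
rewrite Rmult_0_l, Rplus_0_r in H. apply sqrt_le_1_alt in H.
rewrite sqrt_mult, sqrt_square in H; try lra. apply Rle_0_sqr.
Qed.

(** The wave runs down the orbit [W' = - sqrt (U W)]. Since [U 0 = 0] keeps [sqrt U]
    below [2 w], the orbit never reaches 0. *)
Lemma wave_exists (g g1 g2 U : R -> R) :
  monostable g g1 g2 -> flux_profile g U -> U 0 = 0 ->
  exists W, traveling_wave g 2 W.
Proof.
intros hg hU U0.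
destruct (sqrt_flux_le_right _ _ _ _ hg hU) as [m [hm hR]].
assert (hL := sqrt_flux_le_left _ _ _ _ hg hU U0).
assert (hpos : forall t, 0 < t < 1 -> 0 < sqrt (U t)).
{ intros t ht. apply sqrt_lt_R0, (flux_profile_pos _ _ _ _ hg hU _ ht). }
destruct (descending_orbit_exists (fun w => sqrt (U w)) (m + 2)) as [W [hr [hd [hl hl']]]].
- apply (sqrt_flux_continuous _ _ hU).
- exact hpos.
- lra.
- intros t ht. specialize (hL t ht). nra.
- intros t ht. specialize (hR t ht). nra.
- exists W.
  assert (hD : forall x, Derive W x = - sqrt (U (W x))) by (intros; apply is_derive_unique, hd).
  assert (hd2 : forall x, is_derive (Derive W) x (2 * sqrt (U (W x)) - g (W x))).
  { intros x. apply is_derive_ext with (fun x => - sqrt (U (W x))); [intros; symmetry; apply hD|].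
    specialize (hr x). assert (h := sqrt_flux_derive _ _ _ _ hg hU (W x) hr).
    replace (2 * sqrt (U (W x)) - g (W x)) with (- (- sqrt (U (W x)) * (2 - g (W x) / sqrt (U (W x))))).
    - apply (is_derive_opp (fun x => sqrt (U (W x)))).
      apply (is_derive_comp (fun w => sqrt (U w)) W); [exact h|apply hd].
    - field. specialize (hpos _ hr). lra. }
  split; [|split; [|split; [exact hl|split; [exact hl'|]]]].
  + intros x. split; eexists; [apply hd|apply hd2].
  + intros x. rewrite (is_derive_unique _ _ _ (hd2 x)), hD. ring.
  + intros x. rewrite hD. specialize (hpos _ (hr x)). lra.
Qed.

(** * Decay at the leading edge *)

(** For [q = - W' / W] the Riccati equation reads [q' = (q - 1) ^ 2 + o(1)], so [q]
    grows at a definite rate as long as it is below [3 / 4]. Any rate above [1 / 2]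
    would do: it makes [exp x * W ^ 2] integrable. *)
Lemma wave_logslope_large (g g1 g2 W : R -> R) :
  monostable g g1 g2 -> traveling_wave g 2 W ->
  exists X, forall x, X <= x -> 3 / 4 <= - Derive W x / W x.
Proof.
intros hg hW.
assert (hq := wave_logslope_bounds _ _ _ _ _ hg hW).
assert (hr := wave_range _ _ _ hW).
destruct (curvature_bounded _ _ _ hg) as [K [hK B]].
destruct (wave_eventually_below _ _ _ (/ (32 * K)) hW) as [X hX].
{ apply Rinv_0_lt_compat. lra. }
(* at rate [/ 32], a rise from 0 to [3 / 4] takes at most 24 *)
exists (X + 24). intros b hb.
set (q := fun x => - Derive W x / W x) in *. fold (q b).
assert (H : (b - (b - 24)) / 32 - q b <= 0); [|lra].
apply (forward_comparison (fun x => (x - (b - 24)) / 32 - q x)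
  (fun x => / 32 - (q x * q x - 2 * q x + g (W x) / W x)) (b - 24) b); [lra| | | |].
- intros x _. apply continuous_Rminus; [by_smoothness|apply (wave_logslope_continuous _ _ _ hW)].
- intros x _. apply (is_derive_minus (fun x => (x - (b - 24)) / 32) q).
  + auto_derive; [exact I|lra].
  + apply (wave_logslope_derive _ _ _ hW).
- intros x hx hpos. specialize (hX x ltac:(lra)). specialize (hr x).
  assert (ht := reaction_taylor _ _ _ K hg B (W x) ltac:(lra)).
  apply Rabs_le_between in ht.
  assert (hh : 1 - / 32 <= g (W x) / W x).
  { apply Rmult_le_reg_r with (W x); [lra|].
    replace (g (W x) / W x * W x) with (g (W x)) by (field; lra).
    assert (K * W x <= / 32).
    { apply Rle_trans with (K * / (32 * K)); [nra|]. apply Req_le; field; lra. }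
    nra. }
  assert (q x < 3 / 4) by lra. nra.
- specialize (hq (b - 24)). fold (q (b - 24)) in hq. lra.
Qed.

Lemma wave_exp_upper (g g1 g2 W : R -> R) :
  monostable g g1 g2 -> traveling_wave g 2 W ->
  exists C X, 0 < C /\ forall x, X <= x -> W x <= C * exp (- (3 / 4 * x)).
Proof.
intros hg hW. destruct (wave_logslope_large _ _ _ _ hg hW) as [X hX].
assert (hr := wave_range _ _ _ hW).
exists (W X * exp (3 / 4 * X)), X.
split; [apply Rmult_lt_0_compat; [apply hr|apply exp_pos]|]. intros x hx.
assert (H : - (W X * exp (3 / 4 * X)) <= - (W x * exp (3 / 4 * x))).
{ apply (nondecreasing_of_derive (fun x => - (W x * exp (3 / 4 * x)))
    (fun x => - ((Derive W x + 3 / 4 * W x) * exp (3 / 4 * x))) X x hx).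
  - intros y _. apply (continuous_Rcomp (fun x => W x * exp (3 / 4 * x)) Ropp); [|by_smoothness].
    apply continuous_Rmult; [apply (wave_continuous _ _ _ hW)|by_smoothness].
  - intros y _. assert (h := wave_derive _ _ _ hW y).
    auto_derive; [repeat split; eexists; eassumption|]. change (fun x => W x) with W. ring.
  - intros y hy. specialize (hX y ltac:(lra)). specialize (hr y).
    assert (h : - Derive W y / W y * W y = - Derive W y) by (field; lra).
    apply Rmult_le_compat_r with (r := W y) in hX; [|lra].
    assert (he := exp_pos (3 / 4 * y)). rewrite h in hX.
    assert (0 <= - (Derive W y + 3 / 4 * W y) * exp (3 / 4 * y)) by (apply Rmult_le_pos; lra).
    lra. }
rewrite exp_Ropp. assert (he := exp_pos (3 / 4 * x)).
apply Rmult_le_reg_r with (exp (3 / 4 * x)); [exact he|].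
rewrite Rmult_assoc, Rinv_l by lra. lra.
Qed.

(** [W' + 2 W >= 0] says that [exp (2 x) * W] is nondecreasing. *)
Lemma wave_exp_lower (g g1 g2 W : R -> R) :
  monostable g g1 g2 -> traveling_wave g 2 W ->
  forall x, 0 <= x -> W 0 * exp (- (2 * x)) <= W x.
Proof.
intros hg hW x hx.
assert (hl := wave_slope_lower _ _ _ _ _ hg hW).
assert (H : W 0 * exp (2 * 0) <= W x * exp (2 * x)).
{ apply (nondecreasing_of_derive (fun x => W x * exp (2 * x))
    (fun x => (Derive W x + 2 * W x) * exp (2 * x)) 0 x hx).
  - intros y _. apply continuous_Rmult; [apply (wave_continuous _ _ _ hW)|by_smoothness].
  - intros y _. assert (h := wave_derive _ _ _ hW y).
    auto_derive; [repeat split; eexists; eassumption|]. change (fun x => W x) with W. ring.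
  - intros y _. apply Rmult_le_pos; [apply hl|apply Rlt_le, exp_pos]. }
rewrite Rmult_0_r, exp_0 in H. rewrite exp_Ropp. assert (he := exp_pos (2 * x)).
apply Rmult_le_reg_r with (exp (2 * x)); [exact he|].
rewrite Rmult_assoc, Rinv_l by lra. lra.
Qed.

Lemma exp_nondecreasing (x y : R) : x <= y -> exp x <= exp y.
Proof. intros [h| ->]; [apply Rlt_le, exp_increasing, h|apply Rle_refl]. Qed.

Lemma exp_decay_below (a e : R) :
  0 < a -> 0 < e -> exists X, forall x, X <= x -> exp (- (a * x)) < e.
Proof.
intros ha he. exists (/ e / a). intros x hx.
assert (hie := Rinv_0_lt_compat _ he).
assert (h : / e <= a * x).
{ apply Rle_trans with (a * (/ e / a)); [apply Req_le; field; lra|].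
  apply Rmult_le_compat_l; lra. }
rewrite exp_Ropp. rewrite <- (Rinv_inv e). apply Rinv_lt_contravar.
- apply Rmult_lt_0_compat; [exact hie|apply exp_pos].
- assert (H := exp_ineq1 (a * x) ltac:(lra)). lra.
Qed.

Lemma zero_of_exp_decay (l C a X : R) :
  0 < a -> (forall x, X <= x -> Rabs l <= C * exp (- (a * x))) -> l = 0.
Proof.
intros ha H. destruct (Req_dec l 0) as [E|ne]; [exact E|exfalso].
apply Rabs_pos_lt in ne.
assert (hC : 0 < Rabs C + 1) by (assert (h := Rabs_pos C); lra).
destruct (exp_decay_below a (Rabs l / (Rabs C + 1)) ha) as [Y hY]; [apply Rdiv_lt_0_compat; assumption|].
specialize (H (Rmax X Y) (Rmax_l _ _)). specialize (hY (Rmax X Y) (Rmax_r _ _)).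
assert (he := exp_pos (- (a * Rmax X Y))).
assert (h1 : (Rabs C + 1) * exp (- (a * Rmax X Y)) < Rabs l).
{ apply Rmult_lt_compat_l with (r := Rabs C + 1) in hY; [|exact hC].
  replace ((Rabs C + 1) * (Rabs l / (Rabs C + 1))) with (Rabs l) in hY by (field; lra). exact hY. }
assert (h2 := Rle_abs C). nra.
Qed.

(** With [E] the integral of the bound from [x] to infinity, [h - E] is
    nondecreasing and [h + E] nonincreasing; the limit is the supremum of the
    former. *)
Lemma limit_of_exp_small_slope (h h' : R -> R) (C a X : R) :
  0 < a -> 0 <= C ->
  (forall x, is_derive h x (h' x)) ->
  (forall x, X <= x -> Rabs (h' x) <= C * exp (- (a * x))) ->
  exists l, forall x, X <= x -> Rabs (h x - l) <= C / a * exp (- (a * x)).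
Proof.
intros ha hC hd hb.
set (E := fun x => C / a * exp (- (a * x))).
assert (hE : forall x, 0 <= E x).
{ intros x. apply Rmult_le_pos; [apply Rdiv_le_0_compat; lra|apply Rlt_le, exp_pos]. }
assert (hc : forall x, continuous h x) by (intros x; apply (ex_derive_continuous h); eexists; apply hd).
assert (hup : forall x y, X <= x -> x <= y -> h x - E x <= h y - E y).
{ intros x y hx hxy.
  apply (nondecreasing_of_derive (fun x => h x - E x) (fun x => h' x + C * exp (- (a * x))) x y hxy).
  - intros z _. apply continuous_Rminus; [apply hc|unfold E; by_smoothness].
  - intros z _. assert (hz := hd z). unfold E.
    auto_derive; [repeat split; eexists; eassumption|].
    change (fun x => h x) with h. rewrite (is_derive_unique _ _ _ hz). field. lra.
  - intros z hz. specialize (hb z ltac:(lra)). apply Rabs_le_between in hb. lra. }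
assert (hdn : forall x y, X <= x -> x <= y -> h y + E y <= h x + E x).
{ intros x y hx hxy.
  assert (H : - (h x + E x) <= - (h y + E y)); [|lra].
  apply (nondecreasing_of_derive (fun x => - (h x + E x)) (fun x => C * exp (- (a * x)) - h' x) x y hxy).
  - intros z _. apply (continuous_Rcomp (fun x => h x + E x) Ropp); [|by_smoothness].
    apply continuous_Rplus; [apply hc|unfold E; by_smoothness].
  - intros z _. assert (hz := hd z). unfold E.
    auto_derive; [repeat split; eexists; eassumption|].
    change (fun x => h x) with h. rewrite (is_derive_unique _ _ _ hz). field. lra.
  - intros z hz. specialize (hb z ltac:(lra)). apply Rabs_le_between in hb. lra. }
assert (hcross : forall x y, X <= x -> X <= y -> h x - E x <= h y + E y).
{ intros x y hx hy. assert (h1 := hE x). assert (h2 := hE y).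
  destruct (Rle_dec x y) as [l|l].
  - specialize (hup x y hx l). lra.
  - specialize (hdn y x hy ltac:(lra)). lra. }
destruct (completeness (fun z => exists x, X <= x /\ z = h x - E x)) as [l [l1 l2]].
- exists (h X + E X). intros z [x [hx ->]]. apply hcross; lra.
- exists (h X - E X), X. split; [lra|reflexivity].
- exists l. intros x hx. fold (E x). apply Rabs_le.
  assert (h1 : h x - E x <= l) by (apply l1; exists x; split; [exact hx|reflexivity]).
  assert (h2 : l <= h x + E x).
  { apply l2. intros z [y [hy ->]]. apply hcross; assumption. }
  lra.
Qed.

Lemma affine_of_exp_small_curvature (v v' v'' : R -> R) (C a X : R) :
  0 < a -> 0 <= C ->
  (forall x, is_derive v x (v' x)) -> (forall x, is_derive v' x (v'' x)) ->
  (forall x, X <= x -> Rabs (v'' x) <= C * exp (- (a * x))) ->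
  exists A B, forall x, X <= x ->
    Rabs (v' x - A) <= C / a * exp (- (a * x)) /\
    Rabs (v x - A * x - B) <= C / a / a * exp (- (a * x)).
Proof.
intros ha hC h1 h2 hb.
destruct (limit_of_exp_small_slope v' v'' C a X ha hC h2 hb) as [A hA].
destruct (limit_of_exp_small_slope (fun x => v x - A * x) (fun x => v' x - A) (C / a) a X) as [B hB].
- exact ha.
- apply Rdiv_le_0_compat; lra.
- intros x. apply (is_derive_minus v (fun x => A * x)); [apply h1|]. auto_derive; [exact I|ring].
- exact hA.
- exists A, B. intros x hx. split; [apply hA, hx|apply hB, hx].
Qed.

(** The linearization [W'' + 2 W' + W = 0] becomes [v'' = 0] for [v = exp x * W],
    whose derivative is [exp x * (W + W')]: at the leading edge [W] follows
    [(A x + B) exp (- x)]. *)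
Definition edge_expansion (W : R -> R) (A B C X : R) : Prop :=
  forall x, X <= x ->
    Rabs (exp x * (W x + Derive W x) - A) <= C * exp (- (/ 2 * x)) /\
    Rabs (exp x * W x - A * x - B) <= C * exp (- (/ 2 * x)).

Lemma edge_derive (g W : R -> R) :
  traveling_wave g 2 W ->
  (forall x, is_derive (fun x => exp x * W x) x (exp x * (W x + Derive W x))) /\
  (forall x, is_derive (fun x => exp x * (W x + Derive W x)) x (exp x * (W x - g (W x)))).
Proof.
intros hW. split; intros x; assert (h1 := wave_derive _ _ _ hW x);
  assert (h2 := wave_derive2 _ _ _ hW x);
  (auto_derive; [repeat split; eexists; eassumption|]);
  change (fun x => W x) with W; change (fun x => Derive W x) with (Derive W).
- ring.
- rewrite (is_derive_unique _ _ _ h2). ring.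
Qed.

Lemma edge_curvature (g g1 g2 W : R -> R) :
  monostable g g1 g2 -> traveling_wave g 2 W ->
  exists K, 0 < K /\ forall x, Rabs (exp x * (W x - g (W x))) <= K * exp x * (W x * W x).
Proof.
intros hg hW. destruct (curvature_bounded _ _ _ hg) as [K [hK B]].
exists K. split; [exact hK|]. intros x.
assert (hr := wave_range _ _ _ hW x). assert (he := exp_pos x).
assert (ht := reaction_taylor _ _ _ K hg B (W x) ltac:(lra)).
rewrite Rabs_mult, (Rabs_right (exp x)), Rabs_minus_sym by lra.
apply Rle_trans with (exp x * (K * W x * W x)); [apply Rmult_le_compat_l; lra|].
apply Req_le. ring.
Qed.

(** If [v = exp x * W] were [O (exp (- x / 2))], its second derivative, quadratic in
    [W], would be [O (exp (- 2 x))], and so would [v]; then [W = O (exp (- 3 x))],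
    below the rate [exp (- 2 x)] at which a wave must at least decay. *)
Lemma edge_not_zero (g g1 g2 W : R -> R) (C X : R) :
  monostable g g1 g2 -> traveling_wave g 2 W -> ~ edge_expansion W 0 0 C X.
Proof.
intros hg hW hexp. destruct (edge_derive _ _ hW) as [d1 d2].
destruct (edge_curvature _ _ _ _ hg hW) as [K [hK hcurv]].
assert (hr := wave_range _ _ _ hW).
assert (hv : forall x, X <= x -> 0 < exp x * W x <= C * exp (- (/ 2 * x))).
{ intros x hx. destruct (hexp x hx) as [_ h]. apply Rabs_le_between in h.
  split; [apply Rmult_lt_0_compat; [apply exp_pos|apply hr]|lra]. }
destruct (affine_of_exp_small_curvature (fun x => exp x * W x)
  (fun x => exp x * (W x + Derive W x)) (fun x => exp x * (W x - g (W x)))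
  (K * (C * C)) 2 X ltac:(lra)) with (2 := d1) (3 := d2)
  as [A [B hAB]].
- assert (h := Rle_0_sqr C). unfold Rsqr in h. nra.
- intros x hx. apply Rle_trans with (1 := hcurv x). specialize (hv x hx).
  assert (he := exp_pos x). assert (he' := exp_pos (- x)).
  assert (E1 : exp x * exp (- x) = 1) by (rewrite <- exp_plus, Rplus_opp_r; apply exp_0).
  assert (E2 : exp (- (/ 2 * x)) * exp (- (/ 2 * x)) = exp (- x)) by (rewrite <- exp_plus; f_equal; field).
  replace (exp (- (2 * x))) with (exp (- x) * exp (- x)) by (rewrite <- exp_plus; f_equal; ring).
  replace (K * exp x * (W x * W x)) with (K * exp (- x) * ((exp x * W x) * (exp x * W x))).
  2:{ replace (K * exp (- x) * ((exp x * W x) * (exp x * W x)))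
        with (K * exp x * (W x * W x) * (exp x * exp (- x))) by ring. rewrite E1. ring. }
  replace (K * (C * C) * (exp (- x) * exp (- x))) with
     (K * exp (- x) * ((C * exp (- (/ 2 * x))) * (C * exp (- (/ 2 * x))))).
  2:{ rewrite <- E2 at 2. ring. }
  apply Rmult_le_compat_l; [apply Rlt_le, Rmult_lt_0_compat; lra|].
  apply Rmult_le_compat; lra.
- set (C2 := K * (C * C) / 2) in *.
  assert (hcmp : forall x, 0 <= x -> exp (- (2 * x)) <= exp (- (/ 2 * x))).
  { intros x hx. apply exp_nondecreasing. lra. }
  assert (hC2 : 0 <= C2) by (unfold C2; assert (h := Rle_0_sqr C); unfold Rsqr in h; nra).
  assert (hA : A = 0).
  { apply (zero_of_exp_decay A (C + C2) (/ 2) (Rmax X 0)); [lra|]. intros x hx.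
    assert (hx1 := Rmax_l X 0). assert (hx2 := Rmax_r X 0).
    destruct (hexp x ltac:(lra)) as [h1 _]. destruct (hAB x ltac:(lra)) as [h2 _].
    specialize (hcmp x ltac:(lra)). rewrite Rminus_0_r in h1.
    apply Rabs_le_between in h1. apply Rabs_le_between in h2. apply Rabs_le. nra. }
  assert (hB : B = 0).
  { apply (zero_of_exp_decay B (C + C2 / 2) (/ 2) (Rmax X 0)); [lra|]. intros x hx.
    assert (hx1 := Rmax_l X 0). assert (hx2 := Rmax_r X 0).
    destruct (hexp x ltac:(lra)) as [_ h1]. destruct (hAB x ltac:(lra)) as [_ h2].
    specialize (hcmp x ltac:(lra)). rewrite hA in h2.
    apply Rabs_le_between in h1. apply Rabs_le_between in h2. apply Rabs_le. nra. }
  assert (hW0 : W 0 = 0).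
  { apply (zero_of_exp_decay (W 0) (C2 / 2) 1 (Rmax X 0)); [lra|]. intros x hx.
    assert (hx1 := Rmax_l X 0). assert (hx2 := Rmax_r X 0).
    destruct (hAB x ltac:(lra)) as [_ h2]. rewrite hA, hB in h2. apply Rabs_le_between in h2.
    assert (h0 := hr 0). rewrite Rabs_right by lra.
    assert (hl := wave_exp_lower _ _ _ _ hg hW x ltac:(lra)).
    assert (he := exp_pos x).
    assert (E1 : exp x * exp (- (2 * x)) = exp (- x)) by (rewrite <- exp_plus; f_equal; ring).
    assert (E2 : exp (- (2 * x)) = exp (- x) * exp (- x)) by (rewrite <- exp_plus; f_equal; ring).
    rewrite Rmult_1_l. apply Rmult_le_reg_r with (exp (- x)); [apply exp_pos|].
    assert (W 0 * exp (- x) <= exp x * W x).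
    { rewrite <- E1. replace (W 0 * (exp x * exp (- (2 * x)))) with (exp x * (W 0 * exp (- (2 * x)))) by ring.
      apply Rmult_le_compat_l; lra. }
    rewrite Rmult_assoc, <- E2. lra. }
  specialize (hr 0). lra.
Qed.

(** The curvature of [exp x * W] is [O (exp x * W ^ 2) = O (exp (- x / 2))], hence
    the affine asymptotics; the signs come from [W > 0], and [A = B = 0] is excluded
    by [edge_not_zero]. *)
Lemma wave_edge_dichotomy (g g1 g2 W : R -> R) :
  monostable g g1 g2 -> traveling_wave g 2 W ->
  exists A B C X, 0 < C /\ 1 <= X /\ edge_expansion W A B C X /\
    (0 < A \/ A = 0 /\ 0 < B).
Proof.
intros hg hW. destruct (edge_derive _ _ hW) as [d1 d2].
destruct (edge_curvature _ _ _ _ hg hW) as [K [hK hcurv]].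
assert (hr := wave_range _ _ _ hW).
destruct (wave_exp_upper _ _ _ _ hg hW) as [M [X0 [hM hX0]]].
set (X := Rmax X0 1). assert (hx1 : X0 <= X) by apply Rmax_l. assert (hx2 : 1 <= X) by apply Rmax_r.
destruct (affine_of_exp_small_curvature (fun x => exp x * W x)
  (fun x => exp x * (W x + Derive W x)) (fun x => exp x * (W x - g (W x)))
  (K * (M * M)) (/ 2) X ltac:(lra)) with (2 := d1) (3 := d2)
  as [A [B hAB]].
- nra.
- intros x hx. apply Rle_trans with (1 := hcurv x). specialize (hX0 x ltac:(lra)). specialize (hr x).
  assert (he := exp_pos x).
  replace (exp (- (/ 2 * x))) with (exp x * (exp (- (3 / 4 * x)) * exp (- (3 / 4 * x))))
    by (rewrite <- !exp_plus; f_equal; field).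
  replace (K * (M * M) * (exp x * (exp (- (3 / 4 * x)) * exp (- (3 / 4 * x)))))
    with (K * exp x * ((M * exp (- (3 / 4 * x))) * (M * exp (- (3 / 4 * x))))) by ring.
  apply Rmult_le_compat_l; [apply Rlt_le, Rmult_lt_0_compat; lra|].
  apply Rmult_le_compat; lra.
- set (C := K * (M * M) / / 2 / / 2) in *.
  assert (hC : 0 < C).
  { unfold C. apply Rdiv_lt_0_compat; [|lra]. apply Rdiv_lt_0_compat; [|lra].
    apply Rmult_lt_0_compat; [lra|]. apply Rmult_lt_0_compat; lra. }
  assert (hexp : edge_expansion W A B C X).
  { intros x hx. destruct (hAB x hx) as [h1 h2]. split; [|exact h2].
    apply Rle_trans with (1 := h1). apply Rmult_le_compat_r; [apply Rlt_le, exp_pos|].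
    unfold C. assert (0 < K * (M * M)) by (apply Rmult_lt_0_compat; nra).
    set (k := K * (M * M)) in *. replace (k / / 2) with (2 * k) by field.
    replace (2 * k / / 2) with (4 * k) by field. lra. }
  exists A, B, C, X. split; [exact hC|split; [exact hx2|split; [exact hexp|]]].
  assert (hv : forall x, X <= x -> 0 < A * x + B + C * exp (- (/ 2 * x))).
  { intros x hx. destruct (hexp x hx) as [_ h]. apply Rabs_le_between in h.
    assert (0 < exp x * W x) by (apply Rmult_lt_0_compat; [apply exp_pos|apply hr]). lra. }
  destruct (Rtotal_order A 0) as [h|[h|h]]; [exfalso| |left; exact h].
  + set (x := Rmax X ((Rabs B + C) / - A)).
    assert (hxX : X <= x) by apply Rmax_l.
    assert (hxA : (Rabs B + C) / - A <= x) by apply Rmax_r.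
    specialize (hv x hxX).
    assert (he : exp (- (/ 2 * x)) <= 1) by (rewrite <- exp_0; apply exp_nondecreasing; lra).
    assert (hb := Rle_abs B).
    assert (Rabs B + C <= - A * x).
    { apply Rle_trans with (- A * ((Rabs B + C) / - A)); [apply Req_le; field; lra|].
      apply Rmult_le_compat_l; lra. }
    nra.
  + right. split; [exact h|]. subst A.
    destruct (Rtotal_order B 0) as [hB|[hB|hB]]; [exfalso| |exact hB].
    * destruct (exp_decay_below (/ 2) (- B / C) ltac:(lra)) as [Y hY]; [apply Rdiv_lt_0_compat; lra|].
      specialize (hv (Rmax X Y) (Rmax_l _ _)). specialize (hY (Rmax X Y) (Rmax_r _ _)).
      apply Rmult_lt_compat_l with (r := C) in hY; [|exact hC].
      replace (C * (- B / C)) with (- B) in hY by (field; lra). lra.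
    * exfalso. subst B. exact (edge_not_zero _ _ _ _ _ _ hg hW hexp).
Qed.

Lemma edge_slow_little_o (W : R -> R) (A B C X : R) :
  0 < C -> 1 <= X -> edge_expansion W A B C X ->
  little_o_pinfty (fun x => W x - A * (x * exp (- x))) (fun x => x * exp (- x)).
Proof.
intros hC hX hexp eps. assert (heps := cond_pos eps).
exists (Rmax X ((Rabs B + C) / eps)). intros x hx.
assert (h1 := Rmax_l X ((Rabs B + C) / eps)). assert (h2 := Rmax_r X ((Rabs B + C) / eps)).
change (Rabs (W x - A * (x * exp (- x))) <= eps * Rabs (x * exp (- x))).
assert (E1 : exp (- x) * exp x = 1) by (rewrite <- exp_plus, Rplus_opp_l; apply exp_0).
assert (he := exp_pos (- x)).
replace (W x - A * (x * exp (- x))) with (exp (- x) * (exp x * W x - A * x)).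
2:{ replace (exp (- x) * (exp x * W x - A * x)) with ((exp (- x) * exp x) * W x - A * (x * exp (- x))) by ring.
    rewrite E1. ring. }
rewrite !Rabs_mult, (Rabs_right (exp (- x))), (Rabs_right x) by lra.
replace (eps * (x * exp (- x))) with (exp (- x) * (eps * x)) by ring.
apply Rmult_le_compat_l; [lra|].
destruct (hexp x ltac:(lra)) as [_ h].
assert (hle : exp (- (/ 2 * x)) <= 1) by (rewrite <- exp_0; apply exp_nondecreasing; lra).
replace (exp x * W x - A * x) with (exp x * W x - A * x - B + B) by ring.
apply Rle_trans with (1 := Rabs_triang _ _).
apply Rle_trans with (C + Rabs B); [nra|].
apply Rle_trans with (eps * ((Rabs B + C) / eps)); [apply Req_le; field; lra|].
apply Rmult_le_compat_l; lra.
Qed.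

Lemma edge_fast_little_o (W : R -> R) (B C X : R) :
  0 < C -> edge_expansion W 0 B C X ->
  little_o_pinfty (fun x => W x - B * exp (- x)) (fun x => exp (- x)).
Proof.
intros hC hexp eps. assert (heps := cond_pos eps).
destruct (exp_decay_below (/ 2) (eps / C) ltac:(lra)) as [Y hY]; [apply Rdiv_lt_0_compat; lra|].
exists (Rmax X Y). intros x hx.
assert (h1 := Rmax_l X Y). assert (h2 := Rmax_r X Y).
change (Rabs (W x - B * exp (- x)) <= eps * Rabs (exp (- x))).
assert (E1 : exp (- x) * exp x = 1) by (rewrite <- exp_plus, Rplus_opp_l; apply exp_0).
assert (he := exp_pos (- x)).
replace (W x - B * exp (- x)) with (exp (- x) * (exp x * W x - 0 * x - B)).
2:{ replace (exp (- x) * (exp x * W x - 0 * x - B)) with ((exp (- x) * exp x) * W x - B * exp (- x)) by ring.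
    rewrite E1. ring. }
rewrite Rabs_mult, (Rabs_right (exp (- x))), Rmult_comm by lra.
apply Rmult_le_compat_r; [lra|].
destruct (hexp x ltac:(lra)) as [_ h]. apply Rle_trans with (1 := h).
specialize (hY x ltac:(lra)). apply Rmult_lt_compat_l with (r := C) in hY; [|exact hC].
replace (C * (eps / C)) with (pos eps) in hY by (field; lra). lra.
Qed.

(** * Profiles near zero height *)

(** [w ^ 2] is a supersolution: it solves the equation of the reaction [g w = w]. *)
Lemma KPP_flux_at_0 (g g1 g2 U : R -> R) :
  monostable g g1 g2 -> KPP g g1 -> flux_profile g U -> U 0 = 0.
Proof.
intros hg hK hU. assert (hn := flux_profile_nonneg _ _ _ _ hg hU 0 ltac:(lra)).
destruct hU as [cU [U1 dU]].
assert (hs : g1 0 = 1) by apply hg.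
assert (H : U 0 <= 0 * 0 + 0 * (1 - 0)); [|lra].
apply (backward_comparison U (fun w => w * w) (fun w => 4 * sqrt (U w) - 2 * g w) (fun w => 2 * w));
  try lra; auto.
- intros x _. by_smoothness.
- intros x _. auto_derive; [exact I|ring].
- intros x hx hlt. specialize (hK x ltac:(split; lra)). rewrite hs in hK.
  assert (h := sqrt_le_1_alt _ _ (Rlt_le _ _ hlt)). rewrite sqrt_square in h by lra. lra.
Qed.

Lemma edge_logslope_upper (g g1 g2 W : R -> R) (eta : R) :
  monostable g g1 g2 -> traveling_wave g 2 W -> 0 < eta ->
  exists X, forall x, X <= x -> - Derive W x <= (1 + eta) * W x.
Proof.
intros hg hW heta. assert (hr := wave_range _ _ _ hW).
destruct (wave_edge_dichotomy _ _ _ _ hg hW) as [A [B [C [X [hC [hX [hexp hAB]]]]]]].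
assert (hscale : forall x, exp x * (- Derive W x) <= exp x * ((1 + eta) * W x) ->
   - Derive W x <= (1 + eta) * W x).
{ intros x. apply Rmult_le_reg_l, exp_pos. }
destruct hAB as [hA|[hA hB]].
- destruct (exp_decay_below (/ 2) (A / C) ltac:(lra)) as [Y hY]; [apply Rdiv_lt_0_compat; lra|].
  exists (Rmax X Y). intros x hx. assert (h1 := Rmax_l X Y). assert (h2 := Rmax_r X Y).
  apply hscale. destruct (hexp x ltac:(lra)) as [h _]. apply Rabs_le_between in h.
  specialize (hY x ltac:(lra)). apply Rmult_lt_compat_l with (r := C) in hY; [|exact hC].
  replace (C * (A / C)) with A in hY by (field; lra).
  assert (0 < exp x * W x) by (apply Rmult_lt_0_compat; [apply exp_pos|apply hr]). nra.
- set (k := eta * B / (C * (1 + eta))).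
  assert (hk : 0 < k).
  { apply Rdiv_lt_0_compat; apply Rmult_lt_0_compat; lra. }
  destruct (exp_decay_below (/ 2) k ltac:(lra) hk) as [Y hY].
  exists (Rmax X Y). intros x hx. assert (h1 := Rmax_l X Y). assert (h2 := Rmax_r X Y).
  apply hscale. destruct (hexp x ltac:(lra)) as [h h']. apply Rabs_le_between in h. apply Rabs_le_between in h'.
  specialize (hY x ltac:(lra)). subst A.
  apply Rmult_lt_compat_l with (r := C * (1 + eta)) in hY; [|apply Rmult_lt_0_compat; lra].
  replace (C * (1 + eta) * k) with (eta * B) in hY by (unfold k; field; lra). nra.
Qed.

(** Let [z] be the gap between the slopes, at equal height, of the profile of [h]
    and of the wave [W]. It satisfies [z' = (h - g) - (h / sqrt V) z]. On a wave
    without the secular term the coefficient of [z] is at most [1 + O (exp (- x /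
    2))], so [z] decays no faster than [exp (- x)], hence no faster than [W]. But
    both slopes are asymptotic to the height itself. *)
Lemma edge_slow_below (g g1 g2 h h1 h2 U V W : R -> R) (B C X : R) :
  monostable g g1 g2 -> monostable h h1 h2 ->
  (forall w, 0 < w < 1 -> g w < h w) ->
  flux_profile g U -> flux_profile h V -> V 0 = 0 ->
  traveling_wave g 2 W -> 0 < B -> 0 < C -> 1 <= X ->
  ~ edge_expansion W 0 B C X.
Proof.
intros hg hh hlt hU hV V0 hW hB hC hX hexp.
assert (hr := wave_range _ _ _ hW).
set (z := fun x => sqrt (V (W x)) + Derive W x).
set (dz := fun x => (h (W x) - g (W x)) - h (W x) / sqrt (V (W x)) * z x).
assert (hVp : forall x, 0 < sqrt (V (W x))).
{ intros x. apply sqrt_lt_R0, (flux_profile_pos _ _ _ _ hh hV), hr. }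
assert (hz0 : forall x, 0 <= z x).
{ intros x. unfold z. assert (E := wave_slope _ _ _ _ _ hg hU hW x).
  assert (hle : U (W x) <= V (W x) + 2 * 0).
  { apply (flux_profile_le g h); [exact hU|exact hV|lra| |specialize (hr x); lra].
    intros w hw. specialize (hlt w hw). lra. }
  assert (hs := sqrt_le_1_alt (U (W x)) (V (W x)) ltac:(lra)). lra. }
assert (hd : forall x, is_derive z x (dz x)).
{ intros x. assert (e1 := wave_derive _ _ _ hW x). assert (e2 := wave_derive2 _ _ _ hW x).
  assert (e3 := sqrt_flux_derive _ _ _ _ hh hV (W x) (hr x)).
  specialize (hVp x).
  replace (dz x) with (Derive W x * (2 - h (W x) / sqrt (V (W x))) + (- (2) * Derive W x - g (W x))).
  - apply (is_derive_plus (fun x => sqrt (V (W x))) (Derive W)); [|exact e2].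
    apply (is_derive_comp (fun w => sqrt (V w)) W); [exact e3|exact e1].
  - unfold dz, z. field. lra. }
assert (hzp : forall x, 0 < z x).
{ intros x. destruct (Req_dec (z x) 0) as [E|ne]; [exfalso|specialize (hz0 x); lra].
  assert (H : dz x = 0).
  { apply (derive_zero_at_min z (dz x) (x - 1) x (x + 1)); [lra|apply hd|].
    intros y _. rewrite E. apply hz0. }
  unfold dz in H. rewrite E in H. specialize (hlt _ (hr x)). lra. }
destruct (curvature_bounded _ _ _ hh) as [K [hK HK]].
(* With [eps = exp (- x / 2)], the reaction exceeds [W] by at most [a eps W], the slope falls
   short of [W] by at most [b eps W], and [D] is such that
   [1 + a eps <= (1 + D eps) (1 - b eps)] once [b eps <= 1 / 2]. *)
set (a := 2 * B * K). set (b := 2 * C / B). set (D := 2 * (a + b)).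
assert (ha : 0 < a) by (unfold a; apply Rmult_lt_0_compat; lra).
assert (hb : 0 < b) by (unfold b; apply Rdiv_lt_0_compat; lra).
destruct (exp_decay_below (/ 2) (/ (2 * b)) ltac:(lra)) as [Y hY]; [apply Rinv_0_lt_compat; lra|].
set (X1 := Rmax X Y). assert (hx1 : X <= X1) by apply Rmax_l. assert (hx2 : Y <= X1) by apply Rmax_r.
assert (hmain : forall x, X1 <= x ->
   W x <= 2 * B * exp (- x) /\
   W x * (1 - b * exp (- (/ 2 * x))) <= - Derive W x /\
   h (W x) / sqrt (V (W x)) <= 1 + D * exp (- (/ 2 * x))).
{ intros x hx. destruct (hexp x ltac:(lra)) as [e1 e2]. specialize (hY x ltac:(lra)).
  apply Rabs_le_between in e1. apply Rabs_le_between in e2.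
  set (eps := exp (- (/ 2 * x))) in *. assert (heps : 0 < eps) by apply exp_pos.
  assert (hbe : b * eps <= / 2).
  { apply Rle_trans with (b * / (2 * b)); [nra|]. apply Req_le; field; lra. }
  assert (hCe : C * eps <= B / 4).
  { replace (C * eps) with (B / 2 * (b * eps)) by (unfold b; field; lra). nra. }
  assert (hex := exp_pos x).
  assert (E1 : exp (- x) * exp x = 1) by (rewrite <- exp_plus, Rplus_opp_l; apply exp_0).
  assert (hup : W x <= 2 * B * exp (- x)).
  { apply Rmult_le_reg_r with (exp x); [exact hex|]. rewrite Rmult_assoc, E1. lra. }
  assert (hslope : W x * (1 - b * eps) <= - Derive W x).
  { apply Rmult_le_reg_l with (exp x); [exact hex|].
    assert (hbv : C * eps <= b * eps * (exp x * W x)).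
    { replace (C * eps) with (b * eps * (B / 2)) by (unfold b; field; lra).
      apply Rmult_le_compat_l; [apply Rlt_le, Rmult_lt_0_compat; assumption|lra]. }
    lra. }
  split; [exact hup|split; [exact hslope|]].
  assert (hrx := hr x).
  assert (ht := reaction_taylor _ _ _ K hh HK (W x) ltac:(lra)). apply Rabs_le_between in ht.
  assert (hz := hz0 x). unfold z in hz.
  assert (hle : exp (- x) <= eps) by (apply exp_nondecreasing; lra).
  apply Rmult_le_reg_r with (sqrt (V (W x))); [apply hVp|].
  replace (h (W x) / sqrt (V (W x)) * sqrt (V (W x))) with (h (W x)) by (field; specialize (hVp x); lra).
  assert (hD : 0 < D * eps) by (apply Rmult_lt_0_compat; [unfold D; lra|exact heps]).
  apply Rle_trans with ((1 + D * eps) * (W x * (1 - b * eps))); [|apply Rmult_le_compat_l; lra].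
  assert (hKW : K * W x <= a * eps).
  { apply Rle_trans with (K * (2 * B * eps)); [apply Rmult_le_compat_l; [lra|]|unfold a; lra].
    apply Rle_trans with (1 := hup). apply Rmult_le_compat_l; lra. }
  assert (hfac : 1 + a * eps <= (1 + D * eps) * (1 - b * eps)).
  { assert (D * eps * (b * eps) <= D * eps * / 2) by (apply Rmult_le_compat_l; lra).
    unfold D in *. lra. }
  replace ((1 + D * eps) * (W x * (1 - b * eps))) with (W x * ((1 + D * eps) * (1 - b * eps))) by ring.
  apply Rle_trans with (W x * (1 + a * eps)); [|apply Rmult_le_compat_l; lra].
  assert (W x * (K * W x) <= W x * (a * eps)) by (apply Rmult_le_compat_l; lra). lra. }
(* an integrating factor: [E' / E = 1 + D exp (- x / 2)] *)
set (E := fun x => exp (x + - (2 * D * exp (- (/ 2 * x))))).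
set (m := z X1 * E X1).
assert (hm : 0 < m) by (apply Rmult_lt_0_compat; [apply hzp|apply exp_pos]).
assert (hlow : forall x, X1 <= x -> m * exp (- x) <= z x).
{ intros x hx.
  assert (H : z X1 * E X1 <= z x * E x).
  { apply (nondecreasing_of_derive (fun x => z x * E x)
      (fun x => (dz x + z x * (1 + D * exp (- (/ 2 * x)))) * E x) X1 x hx).
    - intros y _. apply continuous_Rmult; [|unfold E; by_smoothness].
      apply (ex_derive_continuous z). eexists. apply hd.
    - intros y _. assert (e := hd y). unfold E.
      auto_derive; [repeat split; eexists; eassumption|].
      change (fun x => z x) with z. rewrite (is_derive_unique _ _ _ e). field.
    - intros y hy. apply Rmult_le_pos; [|apply Rlt_le, exp_pos].
      destruct (hmain y ltac:(lra)) as [_ [_ hq]]. unfold dz.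
      specialize (hlt _ (hr y)).
      assert (h (W y) / sqrt (V (W y)) * z y <= (1 + D * exp (- (/ 2 * y))) * z y)
        by (apply Rmult_le_compat_r; [apply hz0|exact hq]). lra. }
  assert (hE : E x <= exp x).
  { apply exp_nondecreasing. assert (0 < exp (- (/ 2 * x))) by apply exp_pos.
    assert (0 < D * exp (- (/ 2 * x))) by (apply Rmult_lt_0_compat; [unfold D; lra|assumption]). lra. }
  assert (hE2 : z x * E x <= z x * exp x) by (apply Rmult_le_compat_l; [apply hz0|exact hE]).
  fold m in H. assert (hex := exp_pos x). rewrite exp_Ropp.
  apply Rmult_le_reg_r with (exp x); [exact hex|]. rewrite Rmult_assoc, Rinv_l by lra. lra. }
set (mu := m / (2 * B)). assert (hmu : 0 < mu) by (unfold mu; apply Rdiv_lt_0_compat; lra).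
destruct (exp_decay_below (/ 2) (mu / 2 / b) ltac:(lra)) as [Y2 hY2].
{ apply Rdiv_lt_0_compat; lra. }
set (X2 := Rmax X1 Y2). assert (hx3 : X1 <= X2) by apply Rmax_l. assert (hx4 : Y2 <= X2) by apply Rmax_r.
assert (hsteep : forall x, X2 <= x -> (1 + mu / 2) * W x <= sqrt (V (W x))).
{ intros x hx. destruct (hmain x ltac:(lra)) as [q1 [q2 _]]. specialize (hlow x ltac:(lra)).
  specialize (hY2 x ltac:(lra)). specialize (hr x).
  assert (hmW : mu * W x <= m * exp (- x)).
  { apply Rle_trans with (mu * (2 * B * exp (- x))); [apply Rmult_le_compat_l; lra|].
    apply Req_le. unfold mu. field. lra. }
  apply Rmult_lt_compat_l with (r := b) in hY2; [|exact hb].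
  replace (b * (mu / 2 / b)) with (mu / 2) in hY2 by (field; lra).
  unfold z in hlow. nra. }
destruct (wave_exists _ _ _ _ hh hV V0) as [Wh hWh].
destruct (edge_logslope_upper _ _ _ _ (mu / 4) hh hWh ltac:(lra)) as [X3 hX3].
destruct (wave_eventually_below _ _ _ (W X2) hWh (proj1 (hr X2))) as [X4 hX4].
set (y := Rmax X3 X4).
specialize (hX3 y (Rmax_l _ _)). specialize (hX4 y (Rmax_r _ _)).
assert (hry := wave_range _ _ _ hWh y).
destruct (wave_onto _ _ _ (Wh y) hW hry) as [x Ex].
assert (hx : X2 <= x).
{ destruct (Rle_dec X2 x) as [l|l]; [exact l|exfalso].
  assert (hdec := wave_decreasing _ _ _ hW x X2 ltac:(lra)). lra. }
specialize (hsteep x hx). rewrite Ex in hsteep.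
rewrite (wave_slope _ _ _ _ _ hh hV hWh y) in hX3. nra.
Qed.

(** On a wave with a secular term the absolute slope is [W (1 - 1 / |ln W|)] to
    leading order. Halving the correction gives a larger function and leaves room
    for the quadratic part of the reaction. *)
Definition log_barrier (w : R) : R := w * (1 + / (2 * ln w)).

Lemma log_barrier_derive (w : R) :
  0 < w < 1 -> is_derive log_barrier w (1 + / (2 * ln w) - / (2 * (ln w * ln w))).
Proof.
intros hw. assert (hl : ln w < 0) by (rewrite <- ln_1; apply ln_increasing; lra).
unfold log_barrier. auto_derive; [repeat split; lra|]. field. lra.
Qed.

(** With [y = 1 / (2 |ln w|)] the barrier is [w (1 - y)] and its slope is [1 - y - 2
    y ^ 2], so the inequality is [K w <= y ^ 2 - 2 y ^ 3], and [w] is exponentially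
    small in [1 / y]. *)
Lemma log_barrier_supersolution (K : R) :
  0 < K -> exists d, 0 < d < 1 /\
  forall w, 0 < w <= d ->
    0 < log_barrier w <= w /\
    log_barrier w * (1 + / (2 * ln w) - / (2 * (ln w * ln w))) + (w + K * w * w)
      <= 2 * log_barrier w.
Proof.
intros hK. set (T := 2 + 216 * K).
exists (exp (- T)). split.
{ split; [apply exp_pos|]. rewrite <- exp_0. apply exp_increasing. unfold T. lra. }
intros w hw.
assert (hl : ln w <= - T).
{ rewrite <- (ln_exp (- T)). apply ln_le; lra. }
set (t := - ln w). assert (ht : T <= t) by (unfold t; lra).
assert (htw : w = exp (- t)) by (unfold t; rewrite Ropp_involutive, exp_ln; lra).
assert (hT2 : 2 <= t) by (unfold T in ht; lra).
set (y := / (2 * t)).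
assert (hy0 : 0 < y) by (apply Rinv_0_lt_compat; lra).
assert (hy : y <= / 4) by (apply Rinv_le_contravar; lra).
replace (/ (2 * ln w)) with (- y) by (unfold y, t; field; unfold T in *; lra).
replace (/ (2 * (ln w * ln w))) with (2 * (y * y)) by (unfold y, t; field; unfold T in *; lra).
unfold log_barrier. replace (/ (2 * ln w)) with (- y) by (unfold y, t; field; unfold T in *; lra).
(* [exp] beats the cube: [exp t >= (t / 3) ^ 3] *)
assert (hKw : K * w <= y * y / 2).
{ assert (h3 : t / 3 <= exp (t / 3)) by (assert (H := exp_ineq1 (t / 3) ltac:(lra)); lra).
  assert (hcube : t * t * t <= 27 * exp t).
  { replace (exp t) with (exp (t / 3) * exp (t / 3) * exp (t / 3)) by (rewrite <- !exp_plus; f_equal; field).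
    replace (t * t * t) with (27 * (t / 3 * (t / 3) * (t / 3))) by field.
    apply Rmult_le_compat_l; [lra|].
    apply Rmult_le_compat; [nra|lra| |exact h3]. apply Rmult_le_compat; lra. }
  assert (E1 : exp (- t) * exp t = 1) by (rewrite <- exp_plus, Rplus_opp_l; apply exp_0).
  assert (hK8 : 8 * K * (t * t) <= exp t).
  { assert (216 * K * (t * t) <= t * (t * t)) by (apply Rmult_le_compat_r; [nra|unfold T in ht; lra]). lra. }
  rewrite htw. apply Rmult_le_reg_r with (8 * (t * t) * exp t).
  { apply Rmult_lt_0_compat; [nra|apply exp_pos]. }
  replace (K * exp (- t) * (8 * (t * t) * exp t)) with (8 * K * (t * t) * (exp (- t) * exp t)) by ring.
  rewrite E1. replace (y * y / 2 * (8 * (t * t) * exp t)) with (exp t) by (unfold y; field; lra). lra. }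
split; [split; nra|].
assert (0 <= y * y * (/ 4 - y)) by (apply Rmult_le_pos; [nra|lra]).
assert (hfin : w * (K * w) <= w * (y * y - 2 * (y * y * y))) by (apply Rmult_le_compat_l; lra).
lra.
Qed.

Lemma flux_trapped_at_0 (g g1 g2 U : R -> R) (K d w0 : R) :
  monostable g g1 g2 -> flux_profile g U ->
  (forall w, I01 w -> Rabs (g2 w) <= K) -> 0 < d < 1 ->
  (forall w, 0 < w <= d ->
    0 < log_barrier w <= w /\
    log_barrier w * (1 + / (2 * ln w) - / (2 * (ln w * ln w))) + (w + K * w * w)
      <= 2 * log_barrier w) ->
  0 < w0 <= d -> U w0 <= log_barrier w0 * log_barrier w0 -> U 0 = 0.
Proof.
intros hg hU hK hd hbar hw0 hstart.
assert (hn := flux_profile_nonneg _ _ _ _ hg hU).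
destruct hU as [cU [U1 dU]].
assert (hsq : forall w, 0 < w <= w0 -> U w <= w * w).
{ intros w hw.
  assert (H : U w <= log_barrier w * log_barrier w + 0 * (w0 - w)).
  { apply (backward_comparison U (fun w => log_barrier w * log_barrier w)
      (fun w => 4 * sqrt (U w) - 2 * g w)
      (fun w => 2 * log_barrier w * (1 + / (2 * ln w) - / (2 * (ln w * ln w))))); try lra; auto.
    - intros x hx. apply continuous_Rmult; apply (ex_derive_continuous log_barrier);
        eexists; apply log_barrier_derive; lra.
    - intros x hx. apply dU. lra.
    - intros x hx. assert (e := log_barrier_derive x ltac:(lra)).
      auto_derive; [repeat split; eexists; eassumption|].
      change (fun x => log_barrier x) with log_barrier. rewrite (is_derive_unique _ _ _ e). ring.
    - intros x hx hlt. destruct (hbar x ltac:(lra)) as [hp hs].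
      assert (hle := sqrt_le_1_alt _ _ (Rlt_le _ _ hlt)). rewrite sqrt_square in hle by lra.
      assert (ht := reaction_taylor _ _ _ K hg hK x ltac:(lra)). apply Rabs_le_between in ht. lra. }
  destruct (hbar w ltac:(lra)) as [hp _].
  assert (log_barrier w * log_barrier w <= w * w) by (apply Rmult_le_compat; lra). lra. }
destruct (Req_dec (U 0) 0) as [E|ne]; [exact E|exfalso].
assert (hU0 : 0 < U 0) by (specialize (hn 0 ltac:(lra)); lra).
destruct (proj1 (continuous_eps U 0) (cU 0) (U 0 / 2) ltac:(lra)) as [r [hr H]].
set (w := Rmin w0 (Rmin (r / 2) (U 0 / 2))).
assert (h1 : w <= w0) by apply Rmin_l.
assert (h23 : w <= Rmin (r / 2) (U 0 / 2)) by apply Rmin_r.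
assert (h2 := Rmin_l (r / 2) (U 0 / 2)). assert (h3 := Rmin_r (r / 2) (U 0 / 2)).
assert (hw : 0 < w) by (repeat apply Rmin_glb_lt; lra).
specialize (H w ltac:(rewrite Rabs_right; lra)). apply Rabs_def2 in H.
specialize (hsq w ltac:(lra)). nra.
Qed.

(** Here [- W' / W = 1 - v' / v] with [v' / v] close to [1 / x], and [x] is close to
    [- ln W]. *)
Lemma edge_slow_under_barrier (g W : R -> R) (A B C X d : R) :
  traveling_wave g 2 W -> 0 < A -> 0 < C -> 1 <= X -> edge_expansion W A B C X ->
  0 < d < 1 ->
  exists x, 0 < W x <= d /\ - Derive W x < log_barrier (W x).
Proof.
intros hW hA hC hX hexp hd. assert (hr := wave_range _ _ _ hW).
destruct (wave_eventually_below _ _ _ d hW ltac:(lra)) as [Y1 hY1].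
destruct (exp_decay_below (/ 2) (A / (10 * C)) ltac:(lra)) as [Y2 hY2].
{ apply Rdiv_lt_0_compat; lra. }
set (Y3 := 10 * (Rabs B + C) / A).
(* [71 > 64 * 11 / 10], as [v <= 11 / 10 * A x] is to be below [(x / 8) ^ 2 <= exp (x / 4)] *)
set (Y4 := 71 * A).
set (x := Rmax (Rmax X Y1) (Rmax Y2 (Rmax Y3 Y4))).
assert (hx1 : X <= x) by (apply Rle_trans with (Rmax X Y1); apply Rmax_l).
assert (hx2 : Y1 <= x) by (apply Rle_trans with (Rmax X Y1); [apply Rmax_r|apply Rmax_l]).
assert (hxr : Rmax Y2 (Rmax Y3 Y4) <= x) by apply Rmax_r.
assert (hx3 : Y2 <= x) by (apply Rle_trans with (2 := hxr), Rmax_l).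
assert (hxr' : Rmax Y3 Y4 <= x) by (apply Rle_trans with (2 := hxr), Rmax_r).
assert (hx4 : Y3 <= x) by (apply Rle_trans with (2 := hxr'), Rmax_l).
assert (hx5 : Y4 <= x) by (apply Rle_trans with (2 := hxr'), Rmax_r).
exists x. specialize (hY1 x hx2). specialize (hY2 x hx3). specialize (hr x).
split; [lra|].
destruct (hexp x hx1) as [e1 e2]. apply Rabs_le_between in e1. apply Rabs_le_between in e2.
assert (hCe : C * exp (- (/ 2 * x)) <= A / 10).
{ apply Rlt_le. apply Rmult_lt_compat_l with (r := C) in hY2; [|exact hC].
  replace (C * (A / (10 * C))) with (A / 10) in hY2 by (field; lra). exact hY2. }
assert (hC1 : C * exp (- (/ 2 * x)) <= C).
{ assert (exp (- (/ 2 * x)) <= 1) by (rewrite <- exp_0; apply exp_nondecreasing; lra). nra. }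
assert (hBC : Rabs B + C <= A * x / 10).
{ apply Rle_trans with (A * Y3 / 10); [apply Req_le; unfold Y3; field; lra|].
  assert (A * Y3 <= A * x) by (apply Rmult_le_compat_l; lra). lra. }
assert (hB := Rle_abs B). assert (hB' := Rle_abs (- B)). rewrite Rabs_Ropp in hB'.
assert (hAx : 0 < A * x) by (apply Rmult_lt_0_compat; lra).
set (v := exp x * W x) in *. set (v1 := exp x * (W x + Derive W x)) in *.
assert (hv : 0 < v <= 11 / 10 * (A * x)) by lra.
assert (hv1 : 9 / 10 * A <= v1) by lra.
assert (hln : ln (W x) = ln v - x).
{ unfold v. rewrite ln_mult, ln_exp by (first [apply exp_pos|lra]). ring. }
assert (hlv : ln v <= x / 4).
{ rewrite <- (ln_exp (x / 4)). apply ln_le; [lra|].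
  replace (exp (x / 4)) with (exp (x / 8) * exp (x / 8)) by (rewrite <- exp_plus; f_equal; field).
  assert (h8 : x / 8 <= exp (x / 8)) by (assert (H := exp_ineq1 (x / 8) ltac:(lra)); lra).
  assert (x / 8 * (x / 8) <= exp (x / 8) * exp (x / 8)) by (apply Rmult_le_compat; lra).
  assert (71 * A * x <= x * x) by (apply Rmult_le_compat_r; [lra|exact hx5]). lra. }
set (t := x - ln v). assert (ht : 3 / 4 * x <= t) by (unfold t; lra).
unfold log_barrier. replace (ln (W x)) with (- t) by (unfold t; lra).
(* after division by [W] the claim is [v < 2 t v1] *)
assert (hkey : v < 2 * t * v1).
{ assert (3 / 4 * x * (9 / 10 * A) <= t * v1) by (apply Rmult_le_compat; lra). lra. }
apply Rmult_lt_reg_l with (exp x); [apply exp_pos|].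
replace (exp x * - Derive W x) with (v - v1) by (unfold v, v1; ring).
replace (exp x * (W x * (1 + / (2 * - t)))) with (v - v / (2 * t)) by (unfold v; field; lra).
assert (v / (2 * t) < v1); [|lra].
apply Rmult_lt_reg_r with (2 * t); [lra|].
replace (v / (2 * t) * (2 * t)) with v by (field; lra). lra.
Qed.

(** * The threshold *)

Definition flux_closes (g : R -> R) : Prop := exists U, flux_profile g U /\ U 0 = 0.

Lemma minimal_speed_ge_2 (g g1 g2 : R -> R) (c : R) :
  monostable g g1 g2 -> is_minimal_speed g c -> 2 <= c.
Proof.
intros hg hc. destruct (proj2 (hc c) (Rle_refl c)) as [W hW].
exact (wave_speed_ge_2 _ _ _ _ _ hg hW).
Qed.

Lemma minimal_speed_2_iff (g g1 g2 : R -> R) (c : R) :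
  monostable g g1 g2 -> is_minimal_speed g c -> (c = 2 <-> flux_closes g).
Proof.
intros hg hc. split.
- intros ->. destruct (proj2 (hc 2) (Rle_refl 2)) as [W hW].
  destruct (flux_profile_exists _ _ _ hg) as [U hU].
  exists U. split; [exact hU|exact (wave_flux_at_0 _ _ _ _ _ hg hU hW)].
- intros [U [hU U0]]. assert (h := minimal_speed_ge_2 _ _ _ _ hg hc).
  assert (h' : c <= 2) by (apply hc, (wave_exists _ _ _ _ hg hU U0)). lra.
Qed.

(** A larger reaction has a larger profile. *)
Lemma flux_closes_mono (g g1 g2 h h1 h2 : R -> R) :
  monostable g g1 g2 -> monostable h h1 h2 ->
  (forall w, 0 < w < 1 -> g w <= h w) -> flux_closes h -> flux_closes g.
Proof.
intros hg hh hle [V [hV V0]]. destruct (flux_profile_exists _ _ _ hg) as [U hU].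
exists U. split; [exact hU|].
assert (H := flux_profile_le g h U V 0 hU hV (Rle_refl 0)).
specialize (H ltac:(intros w hw; specialize (hle w hw); lra) 0 ltac:(lra)).
assert (H' := flux_profile_nonneg _ _ _ _ hg hU 0 ltac:(lra)). lra.
Qed.

(** The secular term leaves, at some small height, a definite margin below
    [log_barrier]; a slightly larger reaction does not use it up, and below that
    height its profile is trapped. *)
Lemma slow_edge_open (g g1 g2 W : R -> R) (A B C X L : R) :
  monostable g g1 g2 -> traveling_wave g 2 W ->
  0 < A -> 0 < C -> 1 <= X -> edge_expansion W A B C X -> 0 < L ->
  exists eta, 0 < eta /\
    forall h h1 h2, monostable h h1 h2 ->
      (forall w, I01 w -> Rabs (h w - g w) <= L * eta /\ Rabs (h2 w - g2 w) <= L * eta) ->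
      flux_closes h.
Proof.
intros hg hW hA hC hX hexp hL.
destruct (curvature_bounded _ _ _ hg) as [K [hK HK]].
destruct (log_barrier_supersolution (K + L) ltac:(lra)) as [d [hd hbar]].
destruct (edge_slow_under_barrier _ _ _ _ _ _ d hW hA hC hX hexp hd) as [x [hx hlt]].
destruct (flux_profile_exists _ _ _ hg) as [U hU].
assert (hf := wave_flux _ _ _ _ _ hg hU hW x).
assert (hslope : Derive W x < 0) by apply hW.
set (w := W x) in *.
assert (hmargin : U w < log_barrier w * log_barrier w) by (rewrite <- hf; nra).
set (mg := log_barrier w * log_barrier w - U w).
assert (hmg : 0 < mg) by (unfold mg; lra).
set (eta := Rmin 1 (mg / (2 * L))).
assert (he1 : eta <= 1) by apply Rmin_l. assert (he2 : eta <= mg / (2 * L)) by apply Rmin_r.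
assert (heta : 0 < eta) by (apply Rmin_glb_lt; [lra|apply Rdiv_lt_0_compat; lra]).
assert (hLe : 0 <= L * eta <= L) by nra.
assert (hLm : 2 * (L * eta) <= mg).
{ apply Rle_trans with (2 * (L * (mg / (2 * L)))); [nra|]. apply Req_le; field; lra. }
exists eta. split; [exact heta|]. intros h h1 h2 hh hclose.
destruct (flux_profile_exists _ _ _ hh) as [V hV]. exists V. split; [exact hV|].
apply (flux_trapped_at_0 h h1 h2 V (K + L) d w hh hV).
- intros u hu. destruct (hclose u hu) as [_ hc]. specialize (HK u hu).
  replace (h2 u) with (g2 u + (h2 u - g2 u)) by ring.
  apply Rle_trans with (1 := Rabs_triang _ _). lra.
- exact hd.
- exact hbar.
- exact hx.
- assert (H : V w <= U w + 2 * (L * eta)); [|unfold mg in *; lra].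
  apply (flux_profile_le h g); [exact hV|exact hU|lra| |lra].
  intros u hu. destruct (hclose u ltac:(split; lra)) as [hc _]. apply Rabs_le_between in hc. lra.
Qed.

Theorem theorem2p5
  (f f1 f2 : R -> R -> R) (cstar : R -> R) (s1 s2 : R)
  (hA1 : forall s, 0 <= s -> monostable (f s) (f1 s) (f2 s))
  (hcstar : forall s, 0 <= s -> is_minimal_speed (f s) (cstar s))
  (hA2 : lipschitz_in_parameter f f1 f2)
  (hA3 : increasing_in_parameter f f2)
  (hs1 : 0 < s1) (hA4 : KPP (f s1) (f1 s1))
  (hs2 : s1 < s2) (hA5 : 2 < cstar s2) :
  exists sstar : R,
    s1 <= sstar < s2 /\
    (forall s, 0 <= s <= sstar -> cstar s = 2) /\
    (forall s, sstar < s -> 2 < cstar s) /\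
    (forall s W, 0 <= s < sstar -> traveling_wave (f s) (cstar s) W ->
       exists A : R, 0 < A /\
         little_o_pinfty (fun x => W x - A * (x * exp (- x)))
                         (fun x => x * exp (- x))) /\
    (forall W, traveling_wave (f sstar) (cstar sstar) W ->
       exists B : R, 0 < B /\
         little_o_pinfty (fun x => W x - B * exp (- x))
                         (fun x => exp (- x))).
Proof.
set (Z := fun s => flux_closes (f s)).
assert (hiff : forall s, 0 <= s -> (cstar s = 2 <-> Z s)).
{ intros s hs. exact (minimal_speed_2_iff _ _ _ _ (hA1 s hs) (hcstar s hs)). }
assert (hdown : forall s s', 0 <= s -> s <= s' -> Z s' -> Z s).
{ intros s s' hs [hlt|<-]; [|tauto]. apply (flux_closes_mono _ _ _ _ _ _ (hA1 s hs) (hA1 s' ltac:(lra))).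
  intros w hw. apply Rlt_le, (hA3 s s' hs hlt), hw. }
assert (hZ1 : Z s1).
{ destruct (flux_profile_exists _ _ _ (hA1 s1 ltac:(lra))) as [U hU]. exists U.
  split; [exact hU|]. exact (KPP_flux_at_0 _ _ _ _ (hA1 s1 ltac:(lra)) hA4 hU). }
assert (hZ2 : ~ Z s2).
{ intros h. apply hiff in h; lra. }
destruct (completeness (fun s => 0 <= s /\ Z s)) as [ss [hub hlub]].
- exists s2. intros s [hs hZ]. destruct (Rle_dec s s2) as [h|h]; [exact h|exfalso].
  apply hZ2, (hdown s2 s); [lra|lra|exact hZ].
- exists s1. split; [lra|exact hZ1].
- assert (hge : s1 <= ss) by (apply hub; split; [lra|exact hZ1]).
  destruct hA2 as [L [hL hlip]].
  assert (hZss : Z ss).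
  { destruct (flux_profile_exists _ _ _ (hA1 ss ltac:(lra))) as [V hV]. exists V. split; [exact hV|].
    assert (hn := flux_profile_nonneg _ _ _ _ (hA1 ss ltac:(lra)) hV 0 ltac:(lra)).
    destruct (Req_dec (V 0) 0) as [E|ne]; [exact E|exfalso].
    set (r := V 0 / (4 * L)). assert (hr : 0 < r) by (apply Rdiv_lt_0_compat; lra).
    (* a parameter of the set close enough to its supremum bounds [V 0] *)
    assert (hnot : ~ is_upper_bound (fun s => 0 <= s /\ Z s) (ss - r)).
    { intros h. specialize (hlub _ h). lra. }
    apply hnot. intros s [hs hZ]. destruct (Rle_dec s (ss - r)) as [h|h]; [exact h|exfalso].
    assert (hss : s <= ss) by (apply hub; split; assumption).
    destruct hZ as [U [hU U0]].
    assert (H : V 0 <= U 0 + 2 * (L * r)).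
    { apply (flux_profile_le (f ss) (f s)); [exact hV|exact hU|nra| |lra].
      intros w hw. destruct (hlip w ss s ltac:(split; lra) ltac:(lra) hs) as [hc _].
      apply Rabs_le_between in hc. rewrite (Rabs_right (ss - s)) in hc by lra.
      assert (L * (ss - s) <= L * r) by (apply Rmult_le_compat_l; lra). lra. }
    rewrite U0 in H. replace (2 * (L * r)) with (V 0 / 2) in H by (unfold r; field; lra). lra. }
  assert (hlt : ss < s2).
  { destruct (Rlt_dec ss s2) as [h|h]; [exact h|exfalso].
    apply hZ2, (hdown s2 ss); [lra|lra|exact hZss]. }
  assert (hc2 : forall s, 0 <= s <= ss -> cstar s = 2).
  { intros s hs. apply hiff; [lra|]. apply (hdown s ss); [lra|lra|exact hZss]. }
  exists ss. split; [lra|split; [exact hc2|split; [|split]]].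
  + intros s hs. assert (h := minimal_speed_ge_2 _ _ _ _ (hA1 s ltac:(lra)) (hcstar s ltac:(lra))).
    destruct (Req_dec (cstar s) 2) as [E|ne]; [exfalso|lra].
    apply hiff in E; [|lra]. assert (h' : s <= ss) by (apply hub; split; [lra|exact E]). lra.
  + intros s W hs hW. rewrite hc2 in hW by lra.
    assert (hg := hA1 s ltac:(lra)). assert (hh := hA1 ss ltac:(lra)).
    destruct (wave_edge_dichotomy _ _ _ _ hg hW) as [A [B [C [X [hC [hX [hexp [hA|[hA hB]]]]]]]]].
    * exists A. split; [exact hA|]. exact (edge_slow_little_o _ _ _ _ _ hC hX hexp).
    * exfalso. subst A. destruct hZss as [V [hV V0]].
      destruct (flux_profile_exists _ _ _ hg) as [U hU].
      apply (edge_slow_below _ _ _ _ _ _ U V W B C X hg hh); try assumption.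
      intros w hw. apply (hA3 s ss ltac:(lra) ltac:(lra)), hw.
  + intros W hW. rewrite hc2 in hW by lra. assert (hh := hA1 ss ltac:(lra)).
    destruct (wave_edge_dichotomy _ _ _ _ hh hW) as [A [B [C [X [hC [hX [hexp [hA|[hA hB]]]]]]]]].
    * exfalso. destruct (slow_edge_open _ _ _ _ _ _ _ _ L hh hW hA hC hX hexp hL) as [eta [heta H]].
      assert (hZ' : Z (ss + eta)).
      { apply (H _ _ _ (hA1 (ss + eta) ltac:(lra))). intros w hw.
        destruct (hlip w (ss + eta) ss hw ltac:(lra) ltac:(lra)) as [h1 [_ h2]].
        replace (ss + eta - ss) with eta in h1, h2 by ring.
        rewrite (Rabs_right eta) in h1, h2 by lra. split; assumption. }
      assert (h' : ss + eta <= ss) by (apply hub; split; [lra|exact hZ']). lra.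
    * subst A. exists B. split; [exact hB|]. exact (edge_fast_little_o _ _ _ _ hC hexp).
Qed.
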